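(* Let $\mathscr{M}=\{m_n\}_{n\in\mathbb{N}_0}$ be a weight sequence and let $R,S\in\mathbb{N}$ with $R+S=N$. Let $\{u_\eta\}_{\eta\in\mathbb{Z}^S}$ be a sequence in $\mathscr{D}'_{\mathscr{M}}(\mathbb{T}^R)$ such that for every $\varepsilon,h>0$ there is $C_{\varepsilon,h}>0$ with $$|\langle u_\eta,\psi\rangle|\le C_{\varepsilon,h}\cdot\|\psi\|_{\mathscr{M},h}\cdot\left(\sup_{p\in\mathbb{N}_0}\frac{\varepsilon^p(1+|\eta|)^p}{m_p\cdot p!}\right),\qquad\forall\eta\in\mathbb{Z}^S,\ \forall\psi\in\mathcal{E}_{\mathscr{M},h}(\mathbb{T}^R).$$ Then $u:=\sum_{\eta\in\mathbb{Z}^S}u_\eta\,e^{ix\eta}$ is an element of $\mathscr{D}'_{\mathscr{M}}(\mathbb{T}^N)$.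
   Context: $\mathbb{N}=\{1,2,\dots\}$, $\mathbb{N}_0=\mathbb{N}\cup\{0\}$, $\mathbb{T}^N=\mathbb{R}^N/2\pi\mathbb{Z}^N$, and $|\eta|$ is the Euclidean norm of $\eta\in\mathbb{Z}^S$. A weight sequence is a sequence $\mathscr{M}=\{m_n\}_{n\in\mathbb{N}_0}$ of positive reals with: $m_0=m_1=1$; $m_n^2\le m_{n-1}m_{n+1}$ for all $n\in\mathbb{N}$; and there is $H>1$ with $m_{j+k}\le H^{j+k}m_jm_k$ for all $j,k\in\mathbb{N}_0$. For each dimension $d$, $\mathcal{E}_{\mathscr{M}}(\mathbb{T}^d)$ is the space of $f\in C^\infty(\mathbb{T}^d)$ (complex-valued) for which there are $C,h>0$ with $|D^\alpha f(x)|\le C h^{|\alpha|}m_{|\alpha|}|\alpha|!$ for all $x\in\mathbb{T}^d$, $\alpha\in\mathbb{N}_0^d$, where $D=-i\partial$. For $h>0$, $\mathcal{E}_{\mathscr{M},h}(\mathbb{T}^d)$ is the Banach space of those $f$ with $\|f\|_{\mathscr{M},h}:=\sup_{x,\alpha}\frac{|D^\alpha f(x)|}{h^{|\alpha|}m_{|\alpha|}|\alpha|!}<\infty$. $\mathcal{E}_{\mathscr{M}}(\mathbb{T}^d)$ carries the locally convex inductive limit topology of the spaces $\mathcal{E}_{\mathscr{M},h_n}(\mathbb{T}^d)$ for any strictly increasing positive sequence $h_n\to+\infty$ (the topology does not depend on the choice). $\mathscr{D}'_{\mathscr{M}}(\mathbb{T}^d)$ is the topological dual of $\mathcal{E}_{\mathscr{M}}(\mathbb{T}^d)$;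 a sequence $u_n\to u$ in $\mathscr{D}'_{\mathscr{M}}(\mathbb{T}^d)$ if $\langle u_n,\varphi\rangle\to\langle u,\varphi\rangle$ for all $\varphi\in\mathcal{E}_{\mathscr{M}}(\mathbb{T}^d)$. Points of $\mathbb{T}^N$ are written $(t,x)$ with $t\in\mathbb{T}^R$, $x\in\mathbb{T}^S$. For $v\in\mathscr{D}'_{\mathscr{M}}(\mathbb{T}^R)$ and $\eta\in\mathbb{Z}^S$, $v\,e^{ix\eta}\in\mathscr{D}'_{\mathscr{M}}(\mathbb{T}^N)$ is given by $\langle v\,e^{ix\eta},\lambda\rangle=\left\langle v,\int_{\mathbb{T}^S}\lambda(t,x)e^{ix\eta}\,dx\right\rangle$. The series defining $u$ is the limit in $\mathscr{D}'_{\mathscr{M}}(\mathbb{T}^N)$ of the partial sums $s_j:=\sum_{|\eta|\le j}u_\eta\,e^{ix\eta}$ as $j\to\infty$, meaning that $\langle s_j,\lambda\rangle\to\langle u,\lambda\rangle$ for all $\lambda\in\mathcal{E}_{\mathscr{M}}(\mathbb{T}^N)$. *)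

(* Defs.v *)
(* A function on the torus T^d = R^d / 2 pi Z^d is represented by a function
   on R^d = 'rV[R]_d that is 2 pi-periodic in each coordinate. *)
From HB Require Import structures.
From mathcomp Require Import all_boot all_order all_algebra.
From mathcomp Require Import all_classical all_reals all_analysis.
From mathcomp.real_closed Require Import complex.

Set Implicit Arguments.
Unset Strict Implicit.
Unset Printing Implicit Defensive.

Import Order.TTheory GRing.Theory Num.Theory.
Import numFieldNormedType.Exports.

Local Open Scope classical_set_scope.
Local Open Scope ring_scope.

Record weight_sequence (R : realType) (m : nat -> R) : Prop := WeightSequence {
  weight_gt0 : forall n, 0 < m n ;
  weight0 : m 0%N = 1 ;
  weight1 : m 1%N = 1 ;
  weight_logconvex : forall n, m n.+1 ^+ 2 <= m n * m n.+2 ;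
  weight_moderate : exists2 H : R, 1 < H &
    forall j k, m (j + k)%N <= H ^+ (j + k) * m j * m k }.

(* The regular module R[i]^o carries the topology of the complex norm. *)
Definition complex_fun (R : realType) (d : nat) := 'rV[R]_d -> R[i]^o.

Section SmoothFunctions.
Context {R : realType} {d : nat}.
Implicit Types (f g : complex_fun R d) (i : 'I_d) (x : 'rV[R]_d).

Definition pderivable i f : Prop := forall x,
  derivable (fun y => complex.Re (f y)) x (delta_mx 0 i) /\
  derivable (fun y => complex.Im (f y)) x (delta_mx 0 i).

Definition pderive i f : complex_fun R d := fun x =>
  (('D_(delta_mx 0 i) (fun y => complex.Re (f y)) x)
   +i* ('D_(delta_mx 0 i) (fun y => complex.Im (f y)) x))%C.

Fixpoint Ck (k : nat) f : Prop :=
  if k is k'.+1 then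
    continuous f /\ forall i, pderivable i f /\ Ck k' (pderive i f)
  else continuous f.

Definition periodic2pi f : Prop :=
  forall i x, f (x + (2 * pi) *: delta_mx 0 i) = f x.

Definition smooth_torus f : Prop := periodic2pi f /\ forall k, Ck k f.

Definition Dop i f : complex_fun R d := fun x => (0 -i* 1)%C * pderive i f x.

Definition mlen (alpha : {ffun 'I_d -> nat}) : nat := (\sum_i alpha i)%N.

Definition Dalpha (alpha : {ffun 'I_d -> nat}) f : complex_fun R d :=
  foldr (fun i g => iter (alpha i) (Dop i) g) f (enum 'I_d).

Definition cmod (z : R[i]) : R := complex.Re `|z|.

End SmoothFunctions.

Section UltradifferentiableFunctions.
Context {R : realType} (m : nat -> R) {d : nat}.
Implicit Types (f g : complex_fun R d) (h : R).

Definition EM : set (complex_fun R d) := [set f | smooth_torus f /\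
  exists C h : R, [/\ 0 < C, 0 < h & forall x (alpha : {ffun 'I_d -> nat}),
    cmod (Dalpha alpha f x) <=
      C * h ^+ mlen alpha * m (mlen alpha) * (mlen alpha)`!%:R]].

Definition Mnorm h f : \bar R := ereal_sup
  [set r | exists x (alpha : {ffun 'I_d -> nat}),
    r = (cmod (Dalpha alpha f x) /
         (h ^+ mlen alpha * m (mlen alpha) * (mlen alpha)`!%:R))%:E].

Definition EMh h : set (complex_fun R d) :=
  [set f | smooth_torus f /\ (Mnorm h f < +oo)%E].

End UltradifferentiableFunctions.

Section Ultradistributions.
Context {R : realType} (m : nat -> R) (hn : nat -> R) {d : nat}.

Definition inductive_parameters : Prop :=
  [/\ forall n, 0 < hn n, forall n, hn n < hn n.+1 & hn @ \oo --> +oo].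

Definition absolutely_convex (V : set (complex_fun R d)) : Prop :=
  forall f g (a b : R[i]), V f -> V g -> `|a| + `|b| <= 1 ->
    V (a *: f + b *: g).

(* The standard base of neighbourhoods of 0 of the locally convex inductive
   limit of the Banach spaces EMh (hn n): the absolutely convex subsets of EM
   that meet each EMh (hn n) in a neighbourhood of 0 for the norm.  They are
   absorbing in EM because EM is the union of the EMh (hn n). *)
Definition EM_base0 (V : set (complex_fun R d)) : Prop :=
  [/\ V `<=` EM m, absolutely_convex V &
      forall n, exists2 e : R, 0 < e & forall f,
        EMh m (hn n) f -> (Mnorm m (hn n) f < e%:E)%E -> V f].

Definition EM_open (U : set (complex_fun R d)) : Prop :=
  U `<=` EM m /\
  forall f, U f -> exists2 V, EM_base0 V & forall g, V g -> U (f + g).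

(* The topological dual of EM.  A functional on EM is represented by a total
   functional on complex_fun R d whose values outside EM are irrelevant. *)
Definition ultradistribution (u : complex_fun R d -> R[i]^o) : Prop :=
  (forall (a : R[i]) f g, EM m f -> EM m g ->
     u (a *: f + g) = a * u f + u g) /\
  (forall W : set R[i]^o, open W -> EM_open (EM m `&` u @^-1` W)).

Definition ultradistribution_cvg (s : nat -> complex_fun R d -> R[i]^o)
    (u : complex_fun R d -> R[i]^o) : Prop :=
  forall f, EM m f -> s j f @[j --> \oo] --> u f.

End Ultradistributions.

Section PartialFourierSeries.
Context {R : realType}.

Definition expi (theta : R) : R[i] := (cos theta +i* sin theta)%C.

Definition int_circle (g : R -> R[i]) : R[i] :=
  ((\int[lebesgue_measure]_(a in `[0, 2 * pi]) complex.Re (g a))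
   +i* (\int[lebesgue_measure]_(a in `[0, 2 * pi]) complex.Im (g a)))%C.

(* The unnormalized integral over T^s, identified with [0, 2 pi]^s, as an
   iterated integral. *)
Fixpoint int_torus (s : nat) : ('rV[R]_s -> R[i]) -> R[i] :=
  match s with
  | 0%N => fun f => f 0
  | s'.+1 => fun f =>
      int_circle (fun a => int_torus (fun x : 'rV[R]_s' =>
        f (row_mx (a%:M : 'rV[R]_1) x)))
  end.

Definition dotZ (s : nat) (x : 'rV[R]_s) (eta : 'rV[int]_s) : R :=
  \sum_i x 0 i * (eta 0 i)%:~R.

Definition normZ (s : nat) (eta : 'rV[int]_s) : R :=
  Num.sqrt (\sum_i ((eta 0 i)%:~R ^+ 2)).

(* The ultradistribution v e^{i x eta}; the point (t, x) is row_mx t x. *)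
Definition tensor_exp (r s : nat) (v : complex_fun R r -> R[i]^o)
    (eta : 'rV[int]_s) : complex_fun R (r + s) -> R[i]^o :=
  fun lambda => v (fun t =>
    int_torus (fun x => lambda (row_mx t x) * expi (dotZ x eta))).

(* The set of indices of this sum is finite, so the finitely supported sum
   below is the ordinary one. *)
Definition fourier_partial_sum (r s : nat)
    (u : 'rV[int]_s -> complex_fun R r -> R[i]^o) (j : nat) :
    complex_fun R (r + s) -> R[i]^o :=
  fun lambda => \sum_(eta \in [set eta : 'rV[int]_s | normZ eta <= j%:R])
    tensor_exp (u eta) eta lambda.

End PartialFourierSeries.

(* Main.v *)
Require Import Defs.
From HB Require Import structures.
From mathcomp Require Import all_boot all_order all_algebra.
From mathcomp Require Import all_classical all_reals all_analysis.
From mathcomp Require Import finmap ring lra.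
From mathcomp.real_closed Require Import complex.

Set Implicit Arguments.
Unset Strict Implicit.
Unset Printing Implicit Defensive.

Import Order.TTheory GRing.Theory Num.Theory.
Import numFieldNormedType.Exports.

Local Open Scope classical_set_scope.
Local Open Scope ring_scope.

(** Testing u against lambda means pairing each u_eta with the partial Fourier
coefficient lambda_eta(t), the integral over x of lambda(t, x) e^(i x eta).
So the theorem rests on the decay of lambda_eta in eta, measured in the norms
of the test functions on the torus of dimension r.

Integrating by parts p times in the variable x_k gives

  (- eta_k)^p D^alpha lambda_eta = (D_t^alpha D_(x_k)^p lambda)_eta.

If |D^beta lambda| <= B h^|beta| m_|beta| |beta|! for all beta, the right-hand
side is at most a constant times B h^(|alpha| + p) m_(|alpha| + p) (|alpha| + p)!,
and moderate growth of the weights splits this, at the price of a constant H,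
into (h H)^|alpha| m_|alpha| |alpha|! times (h H)^p m_p p!.  Taking for k the
largest coordinate of eta,

  (1 + |eta|)^p ||lambda_eta||_(h H) <= const B A^p m_p p!   for every p

([fourier_coef_decay]).  The bound assumed on u_eta loses the supremum over p
of eps^p (1 + |eta|)^p / (m_p p!), where eps is free.  Using the decay of order
p + q, moderate growth once more, and eps = 1 / (A H), all factors depending on
p cancel, and |<u_eta, lambda_eta>| <= K B (1 + |eta|)^(- q), where K depends
only on h and q ([pairing_decay]).

With q = s + 2 these numbers are summable over Z^s: the ball of radius j has at
most (2 j + 1)^s points, so the partial sums of radius j and j + 1 differ by
at most a multiple of B / (j + 1)^2 ([cvg_freq_sum]).  The limit is linear in
lambda and at most a multiple of B, that is, bounded on each Banach step of the
inductive limit, which is continuity ([ultradistribution_of_bounds]).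

The analysis behind this is that of the iterated integral over the torus.  On
continuous functions it is linear and bounded by the supremum over a compact
period cell, so continuity and differentiability in a parameter follow from
estimates uniform on the cell ([is_derive_torus_integral]); and the integral
of a derivative of a periodic function vanishes
([torus_integral_periodic_derivative]). *)

(** * Continuity of real functions and of row concatenation *)
Section RealContinuity.
Context {R : realType} {T : topologicalType}.
Implicit Types f g : T -> R.

Lemma rcontinuousD f g :
  continuous f -> continuous g -> continuous (fun x => f x + g x).
Proof. by move=> cf cg x; exact: (cvgD (cf x) (cg x)). Qed.

Lemma rcontinuousM f g :
  continuous f -> continuous g -> continuous (fun x => f x * g x).
Proof. by move=> cf cg x; exact: (cvgM (cf x) (cg x)). Qed.

Lemma rcontinuousN f : continuous f -> continuous (fun x => - f x).
Proof. by move=> cf x; exact: (cvgN (cf x)). Qed.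

Lemma rcontinuousB f g :
  continuous f -> continuous g -> continuous (fun x => f x - g x).
Proof. by move=> cf cg; apply: rcontinuousD => //; exact: rcontinuousN. Qed.

Lemma rcontinuousZ f c : continuous f -> continuous (fun x => c * f x).
Proof. by move=> cf x; exact: (cvgM (cvg_cst c) (cf x)). Qed.

Lemma rcontinuous_comp (U : topologicalType) (g : T -> U) (f : U -> R) :
  continuous f -> continuous g -> continuous (fun x => f (g x)).
Proof.
by move=> cf cg x; apply: (@continuous_comp _ _ _ g f); [exact: cg|exact: cf].
Qed.

End RealContinuity.

Lemma continuous_slice (T U V : topologicalType) (G : T * U -> V) (t : T) :
  continuous G -> continuous (fun u => G (t, u)).
Proof.
move=> cG u; apply: (@continuous_comp _ _ _ (fun u => (t, u)) G); last exact: cG.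
apply: cvg_pair; [exact: cvg_cst|exact: cvg_id].
Qed.

Section RowTopology.
Context {R : realType}.

Lemma continuous_entries (T : topologicalType) (a b : nat) (f : T -> 'M[R]_(a, b)) :
  (forall i j, continuous (fun z => f z i j)) -> continuous f.
Proof.
move=> cf z; apply/cvg_ballP => e e0.
have H : \forall w \near z, forall i j, ball (f z i j) e (f w i j).
  apply: filter_forall => i; apply: filter_forall => j.
  by have /cvg_ballP := cf i j z; apply.
by apply: filterS H => w Hw; split.
Qed.

Lemma continuous_row_mx (T : topologicalType) (a b : nat)
    (f : T -> 'rV[R]_a) (g : T -> 'rV[R]_b) :
  continuous f -> continuous g -> continuous (fun z => row_mx (f z) (g z)).
Proof.
move=> cf cg; apply: continuous_entries => i j.
case: (split_ordP j) => k ->.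
  under eq_fun do rewrite row_mxEl.
  by move=> z; apply: (@continuous_comp _ _ _ f (fun M => M i k));
    [exact: cf|exact: coord_continuous].
under eq_fun do rewrite row_mxEr.
by move=> z; apply: (@continuous_comp _ _ _ g (fun M => M i k));
  [exact: cg|exact: coord_continuous].
Qed.

Lemma continuous_scalar_mx1 (T : topologicalType) (f : T -> R) :
  continuous f -> continuous (fun z => (f z)%:M : 'rV[R]_1).
Proof.
move=> cf; apply: continuous_entries => i j; rewrite !ord1.
by under eq_fun do rewrite mxE eqxx mulr1n.
Qed.

Lemma continuous_row_mx_cons s (f : 'rV[R]_s.+1 -> R) : continuous f ->
  continuous (fun z : R * 'rV[R]_s => f (row_mx (z.1%:M : 'rV[R]_1) z.2) : R).
Proof.
move=> cf.
have crow : continuous (fun z : R * 'rV[R]_s => row_mx (z.1%:M : 'rV[R]_1) z.2).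
  apply: continuous_row_mx => [|w]; last exact: cvg_snd.
  by apply: continuous_scalar_mx1 => w; exact: cvg_fst.
exact: (rcontinuous_comp cf crow).
Qed.

Lemma row_mx_translatel a b (x : 'rV[R]_a) (y : 'rV[R]_b) c j :
  row_mx x y + c *: delta_mx 0 (lshift b j) = row_mx (x + c *: delta_mx 0 j) y.
Proof. by rewrite delta_mx_lshift scale_row_mx add_row_mx scaler0 addr0. Qed.

Lemma row_mx_translater a b (x : 'rV[R]_a) (y : 'rV[R]_b) c j :
  row_mx x y + c *: delta_mx 0 (rshift a j) = row_mx x (y + c *: delta_mx 0 j).
Proof. by rewrite delta_mx_rshift scale_row_mx add_row_mx scaler0 addr0. Qed.

End RowTopology.

(** * Iterated integrals of real functions over a period cell *)
Section TorusIntegral.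
Context {R : realType}.
Local Notation mu := (@lebesgue_measure R).

Fixpoint torus_integral (s : nat) : ('rV[R]_s -> R) -> R :=
  match s with
  | 0%N => fun f => f 0
  | s'.+1 => fun f =>
      \int[mu]_(a in `[0, 2 * pi]) torus_integral (fun x : 'rV[R]_s' =>
        f (row_mx (a%:M : 'rV[R]_1) x))
  end.

Definition cell (s : nat) : set 'rV[R]_s :=
  [set x | forall i, `[0, 2 * pi]%classic (x ord0 i)].

Arguments cell s : clear implicits.

Lemma compact_cell s : compact (cell s).
Proof.
by apply: (@rV_compact _ _ (fun=> `[0, 2 * pi]%classic)) => i; exact: segment_compact.
Qed.

Lemma integrable_period (f : R -> R) : continuous f ->
  mu.-integrable `[0, 2 * pi] (EFin \o f).
Proof.
move=> cf; apply: continuous_compact_integrable; first exact: segment_compact.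
exact: continuous_subspaceT.
Qed.

(** The tube lemma: joint continuity and compactness of the cell make the
dependence on the parameter uniform in the integration variable. *)
Lemma near_cell (T : topologicalType) s (G : T -> 'rV[R]_s -> R) (t : T) (e : R) :
  0 < e -> continuous (fun z : T * 'rV[R]_s => G z.1 z.2) ->
  \forall t' \near t, forall x, cell s x -> `|G t' x - G t x| <= e.
Proof.
move=> e0 cG.
have := @compact_cell s; rewrite compact_near_coveringP.
move=> /(_ T (nbhs t) (fun t' x => `|G t' x - G t x| <= e)); apply => x _.
have e20 : 0 < e / 2 by rewrite divr_gt0.
have /cvgrPdist_le/(_ _ e20) H1 := cG (t, x).
have H2 : \forall x' \near x, `|G t x - G t x'| <= e / 2.
  by have := continuous_slice cG (t:=t); move=> /(_ x)/cvgrPdist_le/(_ _ e20).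
case: H1 => -[U V] /= [Ut Vx] UV.
exists (V `&` [set x' | `|G t x - G t x'| <= e / 2], U) => /=.
  by split=> //; exact: filterI.
move=> [x' t'] /= [[Vx' Hx'] Ut'].
have := UV (t', x') (conj Ut' Vx') => /= H.
rewrite (splitr e) -(subrK (G t x) (G t' x')) -addrA.
by rewrite (le_trans (ler_normD _ _))// lerD// distrC.
Qed.

(** Linearity and the supremum bound travel together because the induction on
the dimension needs both: they make the inner integral continuous in the
outer variable, hence integrable. *)
Definition bounded_linear s := [/\
  forall f g : 'rV[R]_s -> R, continuous f -> continuous g -> forall c,
    torus_integral (fun x => c * f x + g x) = c * torus_integral f + torus_integral g &
  forall (f : 'rV[R]_s -> R) B, continuous f -> (forall x, cell s x -> `|f x| <= B) ->
    `|torus_integral f| <= (2 * pi) ^+ s * B].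

(** Continuity in a parameter takes nothing of the integral but its being a
bounded functional, because the integrands converge uniformly on the cell. *)
Lemma bounded_linear_continuous_param s (T : topologicalType) (G : T -> 'rV[R]_s -> R) :
  bounded_linear s ->
  continuous (fun z : T * 'rV[R]_s => G z.1 z.2) ->
  continuous (fun t => torus_integral (G t)).
Proof.
move=> [lin bnd] cG t; apply/cvgrPdist_le => e e0.
have cGt t' : continuous (G t') by exact: (continuous_slice cG (t:=t')).
have p0 : 0 < (2 * pi) ^+ s :> R by rewrite exprn_gt0// mulr_gt0// pi_gt0.
have ep : 0 < e / (2 * pi) ^+ s by rewrite divr_gt0.
have := near_cell t ep cG; apply: filterS => t' H.
rewrite distrC.
have -> : torus_integral (G t') - torus_integral (G t) =
    torus_integral (fun x => -1 * G t x + G t' x).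
  by rewrite lin// mulN1r addrC.
rewrite (le_trans (bnd _ (e / (2 * pi) ^+ s) _ _))//.
- by apply: rcontinuousD => //; exact: rcontinuousZ.
- by move=> x /H; rewrite mulN1r addrC.
- by rewrite mulrC divfK// gt_eqF.
Qed.

(** In the induction step, continuity of the inner integral in the outer
variable is what gives access to linearity and monotonicity of the Lebesgue
integral over one period. *)
Lemma torus_integral_bounded_linear s : bounded_linear s.
Proof.
elim: s => [|s IH].
  split=> // f B _ H; rewrite expr0 mul1r; apply: H => -[] //.
have cint (f : 'rV[R]_s.+1 -> R) (cf : continuous f) :
    continuous (fun a : R => torus_integral (fun x : 'rV[R]_s =>
      f (row_mx (a%:M : 'rV[R]_1) x))).
  exact: (@bounded_linear_continuous_param _ R
    (fun a x => f (row_mx (a%:M : 'rV[R]_1) x)) IH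
    (continuous_row_mx_cons cf)).
have slicea (f : 'rV[R]_s.+1 -> R) (cf : continuous f) a :
    continuous (fun x : 'rV[R]_s => f (row_mx (a%:M : 'rV[R]_1) x) : R).
  exact: (continuous_slice (continuous_row_mx_cons cf) (t := a)).
case: IH => lin bnd; split=> [f g cf cg c|f B cf H] /=.
  under eq_Rintegral => a _ do rewrite (lin _ _ (slicea _ cf a) (slicea _ cg a)).
  rewrite RintegralD ?RintegralZl//.
  - by apply: integrable_period; apply: cint.
  - by apply: (@integrable_period (fun x => c * _)); apply: rcontinuousZ; exact: cint.
  - by apply: integrable_period; apply: cint.
have p0 : 0 <= 2 * pi :> R by rewrite mulr_ge0 ?pi_ge0.
rewrite (le_trans (le_normr_Rintegral _ _))//; first
  by apply: integrable_period; apply: cint.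
have -> : (2 * pi) ^+ s.+1 * B = \int[mu]_(a in `[0, 2 * pi]) ((2 * pi) ^+ s * B).
  rewrite Rintegral_cst//= lebesgue_measure_itv/= lte_fin lt_neqAle p0 andbT.
  by case: eqP => [<-|_]; rewrite /= ?subr0 exprS; ring.
apply: le_Rintegral => //.
- apply: (@integrable_period (fun a => `|_|)).
  by apply: (rcontinuous_comp (@norm_continuous _ _)); exact: cint.
- by apply: (@integrable_period (fun a => _)) => a; exact: cvg_cst.
move=> a /= a01; apply: bnd; first exact: slicea.
move=> x cx; apply: H => i /=.
rewrite mxE; case: splitP => j _; last exact: cx.
by rewrite !ord1 mxE eqxx mulr1n.
Qed.

End TorusIntegral.

Arguments cell {R} s _.

(** * Directional derivatives and derivatives of parameter integrals *)
Section DerivativeAlongAffineMap.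
Context {R : numFieldType} {U V W : normedModType R}.

(** Difference quotients only see the line through the point, so a directional
derivative is preserved by any map carrying one line to the other at unit
speed. *)
Lemma is_derive_affine (f : V -> W) (g : U -> V) (q u : U) (v : V) (df : W) :
  (forall h : R, g (h *: u + q) = h *: v + g q) ->
  is_derive (g q) v f df -> is_derive q u (fun y => f (g y)) df.
Proof.
move=> gE [fd fE].
have e : (fun h : R => h^-1 *: (((fun y => f (g y)) \o shift q) (h *: u) - f (g q))) =
    (fun h : R => h^-1 *: ((f \o shift (g q)) (h *: v) - f (g q))).
  by apply/funext => h /=; rewrite gE.
split; first by rewrite /derivable e.
by rewrite /derive e.
Qed.

End DerivativeAlongAffineMap.

Section RealDirectionalDerivatives.
Context {R : realType}.

(** A directional derivative is one of a function of a single real variable,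
which brings it within reach of [is_derive_torus_integral]. *)
Lemma is_derive_line n (f : 'rV[R]_n -> R) (t v : 'rV[R]_n) (d : R) :
  is_derive (0 : R) 1 (fun h : R => f (h *: v + t)) d -> is_derive t v f d.
Proof.
move=> [fd fE].
have e : (fun h : R => h^-1 *: ((f \o shift t) (h *: v) - f t)) =
    (fun h : R => h^-1 *: (((fun h : R => f (h *: v + t)) \o shift 0) (h *: 1) -
                          f (0 *: v + t))).
  by apply/funext => h /=; rewrite addr0 scale0r add0r -[h%:A]/(h * 1) mulr1.
by split; [rewrite /derivable e|rewrite /derive e].
Qed.

Lemma is_derive_scale (V : normedModType R) (f : V -> R) (t v : V) (c d : R) :
  is_derive t v f d -> is_derive t v (fun x => c * f x) (c * d).
Proof. by move=> fd; exact: (is_deriveZ c fd). Qed.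

End RealDirectionalDerivatives.

Section TorusIntegralCalculus.
Context {R : realType}.
Local Notation mu := (@lebesgue_measure R).

Lemma torus_integralD s (f g : 'rV[R]_s -> R) : continuous f -> continuous g ->
  torus_integral (fun x => f x + g x) = torus_integral f + torus_integral g.
Proof.
move=> cf cg; have [lin _] := @torus_integral_bounded_linear R s.
have := lin _ _ cf cg 1; rewrite mul1r => <-.
by congr torus_integral; apply/funext => x; rewrite mul1r.
Qed.

Lemma torus_integralZ s (f : 'rV[R]_s -> R) c : continuous f ->
  torus_integral (fun x => c * f x) = c * torus_integral f.
Proof.
move=> cf; have [lin bnd] := @torus_integral_bounded_linear R s.
have c0 : continuous (fun _ : 'rV[R]_s => 0 : R) by exact: cst_continuous.
have E0 : torus_integral (fun _ : 'rV[R]_s => 0 : R) = 0.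
  apply/eqP; rewrite -normr_le0; have := bnd _ 0 c0; rewrite mulr0; apply=> x _.
  by rewrite normr0.
rewrite -[RHS]addr0 -[X in _ + X]E0 -lin//.
by congr torus_integral; apply/funext => x; rewrite addr0.
Qed.

Lemma torus_integralN s (f : 'rV[R]_s -> R) : continuous f ->
  torus_integral (fun x => - f x) = - torus_integral f.
Proof.
move=> cf; rewrite -mulN1r -torus_integralZ//; congr torus_integral.
by apply/funext => x; rewrite mulN1r.
Qed.

Lemma torus_integralB s (f g : 'rV[R]_s -> R) : continuous f -> continuous g ->
  torus_integral (fun x => f x - g x) = torus_integral f - torus_integral g.
Proof.
by move=> cf cg; rewrite torus_integralD ?torus_integralN//; exact: rcontinuousN.
Qed.

Lemma torus_integral_le s (f : 'rV[R]_s -> R) B : continuous f ->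
  (forall x, cell s x -> `|f x| <= B) -> `|torus_integral f| <= (2 * pi) ^+ s * B.
Proof. by have [_ bnd] := @torus_integral_bounded_linear R s; exact: bnd. Qed.

Lemma continuous_torus_integral s (T : topologicalType) (G : T -> 'rV[R]_s -> R) :
  continuous (fun z : T * 'rV[R]_s => G z.1 z.2) ->
  continuous (fun t => torus_integral (G t)).
Proof.
exact: (@bounded_linear_continuous_param _ _ _ G (@torus_integral_bounded_linear R s)).
Qed.

(** A form of the mean value theorem that does not mention the order of the two
points, so that a signed increment needs no case distinction. *)
Lemma MVT_dist (f df : R -> R) (a b : R) :
  (forall x : R, is_derive x 1 f (df x)) ->
  exists2 c, `|c - a| <= `|b - a| & f b - f a = df c * (b - a).
Proof.
move=> fd; have cf : continuous f.
  by move=> x; apply/differentiable_continuous/derivable1_diffP; case: (fd x).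
have [ab|ba] := leP a b.
  have [c] := MVT_segment ab (fun x _ => fd x) (continuous_subspaceT cf).
  rewrite in_itv/= => /andP[ac cb] E; exists c => //.
  by rewrite !ger0_norm ?subr_ge0// lerD2r.
have [c] := MVT_segment (ltW ba) (fun x _ => fd x) (continuous_subspaceT cf).
rewrite in_itv/= => /andP[bc ca] E; exists c.
  by rewrite distrC [leRHS]distrC !ger0_norm ?subr_ge0 ?(ltW ba)// lerD2l lerN2.
by rewrite -opprB E -mulrN opprB.
Qed.

(** By the mean value theorem the difference quotient of the integrand is a
value of its derivative at a nearby parameter, and such values converge
uniformly on the cell. *)
Lemma is_derive_torus_integral s (G dG : R -> 'rV[R]_s -> R) (a : R) :
  continuous (fun z : R * 'rV[R]_s => G z.1 z.2) ->
  continuous (fun z : R * 'rV[R]_s => dG z.1 z.2) ->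
  (forall (b : R) x, is_derive b 1 (fun b => G b x) (dG b x)) ->
  is_derive a 1 (fun b => torus_integral (G b)) (torus_integral (dG a)).
Proof.
move=> cG cdG Gd.
have cGt t : continuous (G t) by exact: (continuous_slice cG (t:=t)).
have cdGt t : continuous (dG t) by exact: (continuous_slice cdG (t:=t)).
set F := fun b => torus_integral (G b).
suff H : h^-1 *: ((F \o shift a) (h *: 1) - F a) @[h --> 0^'] --> torus_integral (dG a).
  split; first by apply/cvg_ex; exists (torus_integral (dG a)).
  exact: cvg_lim H.
apply/cvgrPdist_le => e e0.
have p0 : 0 < (2 * pi) ^+ s :> R by rewrite exprn_gt0// mulr_gt0// pi_gt0.
have ep : 0 < e / (2 * pi) ^+ s by rewrite divr_gt0.
have /nbhs_ballP[d /= d0 Hd] := near_cell a ep cdG.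
near=> h.
have h0 : h != 0 by near: h; exact: nbhs_dnbhs_neq.
have hd : `|h| < d by near: h; exact: dnbhs0_lt.
rewrite /F /= -[h%:A]/(h * 1) mulr1.
rewrite -torus_integralB// -[_ *: _]/(_ * _) -torus_integralZ; last exact: rcontinuousB.
rewrite -torus_integralB//; last by apply: rcontinuousZ; exact: rcontinuousB.
apply: (le_trans (torus_integral_le (B := e / (2 * pi) ^+ s) _ _)).
- by apply: rcontinuousB => //; apply: rcontinuousZ; exact: rcontinuousB.
- move=> x cx.
  have [c ca ->] := MVT_dist a (h + a) (fun b => Gd b x).
  rewrite addrK [dG c x * h]mulrC mulKf// distrC.
  apply: Hd => //; rewrite /ball /= distrC (le_lt_trans ca)//.
  by rewrite addrK.
- by rewrite mulrC divfK// gt_eqF.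
Unshelve. all: by end_near. Qed.

(** If the differentiated variable is the outermost one, differentiate under the
inner integrals and apply the fundamental theorem of calculus: periodicity
makes the boundary terms cancel.  Otherwise the inner integral already
vanishes, by induction on the dimension. *)
Lemma torus_integral_periodic_derivative s (g dg : 'rV[R]_s -> R) (k : 'I_s) :
  continuous g -> continuous dg ->
  (forall x, is_derive x (delta_mx 0 k) g (dg x)) ->
  (forall x, g (x + (2 * pi) *: delta_mx 0 k) = g x) ->
  torus_integral dg = 0.
Proof.
elim: s g dg k => [|s IH] g dg k cg cdg gd gp; first by case: k {gd gp}.
have slicea (f : 'rV[R]_s.+1 -> R) (cf : continuous f) a :
    continuous (fun x : 'rV[R]_s => f (row_mx (a%:M : 'rV[R]_1) x) : R).
  exact: (continuous_slice (continuous_row_mx_cons cf) (t := a)).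
case: (split_ordP (k : 'I_(1 + s))) => j kj /=.
  have lineE (x : 'rV[R]_s) (b c : R) : row_mx (b%:M : 'rV[R]_1) x + c *: delta_mx 0 k =
       row_mx ((b + c)%:M : 'rV[R]_1) x :> 'rV[R]_(1 + s).
    rewrite kj; etransitivity; first exact: row_mx_translatel.
    congr row_mx.
    by apply/rowP => i; rewrite !ord1 !mxE !eqxx mulr1n mulr1.
  set F := fun a : R => torus_integral (fun x : 'rV[R]_s => g (row_mx (a%:M : 'rV[R]_1) x)).
  have Fd (a : R) : is_derive a 1 F
      (torus_integral (fun x : 'rV[R]_s => dg (row_mx (a%:M : 'rV[R]_1) x))).
    apply: (@is_derive_torus_integral s (fun a x => g (row_mx (a%:M : 'rV[R]_1) x))
      (fun a x => dg (row_mx (a%:M : 'rV[R]_1) x)) a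
      (continuous_row_mx_cons cg) (continuous_row_mx_cons cdg)) => b x.
    refine (is_derive_affine (q := b) (u := 1) (g := fun b => row_mx (b%:M : 'rV[R]_1) x)
      _ (gd (row_mx (b%:M : 'rV[R]_1) x))).
    by move=> h; rewrite [RHS]addrC lineE addrC -[h%:A]/(h * 1) mulr1.
  have cF : continuous F.
    by move=> a; apply/differentiable_continuous/derivable1_diffP; case: (Fd a).
  have p0 : 0 < 2 * pi :> R by rewrite mulr_gt0// pi_gt0.
  rewrite /Rintegral (continuous_FTC2 (F := F) p0).
  - suff -> : F (2 * pi) = F 0 by rewrite -EFinB subrr.
    rewrite -[2 * pi]add0r /F; congr torus_integral; apply/funext => x.
    by rewrite -lineE gp.
  - apply: continuous_subspaceT.
    exact: (@continuous_torus_integral s R (fun a x => dg (row_mx (a%:M : 'rV[R]_1) x))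
       (continuous_row_mx_cons cdg)).
  - split=> [a _||]; first by case: (Fd a).
    + by apply: cvg_at_right_filter; exact: cF.
    + by apply: cvg_at_left_filter; exact: cF.
  - by move=> a _; rewrite derive1E; case: (Fd a).
have lineE (a : R) (x : 'rV[R]_s) c : row_mx (a%:M : 'rV[R]_1) x + c *: delta_mx 0 k =
     row_mx (a%:M : 'rV[R]_1) (x + c *: delta_mx 0 j) :> 'rV[R]_(1 + s).
  by rewrite kj; exact: row_mx_translater.
transitivity (\int[mu]_(a in `[0, 2 * pi]) (0 : R)); last by rewrite Rintegral_cst// mul0r.
apply: eq_Rintegral => a _; apply: (IH (fun x => g (row_mx (a%:M : 'rV[R]_1) x)) _ j).
- exact: slicea.
- exact: slicea.
- move=> x; refine (is_derive_affine (q := x) (u := delta_mx 0 j)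
    (g := fun x => row_mx (a%:M : 'rV[R]_1) x) _ (gd (row_mx (a%:M : 'rV[R]_1) x))).
  by move=> h; rewrite addrC -lineE addrC.
- by move=> x; rewrite -lineE gp.
Qed.

End TorusIntegralCalculus.

(** * The modulus and convergence of complex numbers *)
Section ComplexModulus.
Context {R : realType}.
Implicit Types z w : R[i].

Lemma cmodE z : (cmod z)%:C%C = `|z|.
Proof. by rewrite /cmod normc_def. Qed.

Lemma cmod_ge0 z : 0 <= cmod z.
Proof. by rewrite -lecR cmodE normr_ge0. Qed.

Lemma cmod0 : cmod (0 : R[i]) = 0.
Proof. by rewrite /cmod normr0. Qed.

Lemma cmodM z w : cmod (z * w) = cmod z * cmod w.
Proof. by apply: complexI; rewrite rmorphM /= !cmodE normrM. Qed.

Lemma cmodN z : cmod (- z) = cmod z.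
Proof. by rewrite /cmod normrN. Qed.

Lemma cmodX z n : cmod (z ^+ n) = cmod z ^+ n.
Proof. by apply: complexI; rewrite rmorphXn /= !cmodE normrX. Qed.

Lemma cmodD z w : cmod (z + w) <= cmod z + cmod w.
Proof. by rewrite -lecR rmorphD /= !cmodE ler_normD. Qed.

Lemma cmod_real (x : R) : cmod x%:C%C = `|x|.
Proof. by rewrite /cmod normc_def /= expr0n/= addr0 sqrtr_sqr. Qed.

Lemma cmod_i (x : R) : cmod (0 +i* x)%C = `|x|.
Proof. by rewrite /cmod normc_def /= expr0n/= add0r sqrtr_sqr. Qed.

Lemma cmod_le_ReIm z : cmod z <= `|complex.Re z| + `|complex.Im z|.
Proof.
case: z => a b /=; rewrite -(cmod_real a) -(cmod_i b).
have -> : (a +i* b)%C = a%:C%C + (0 +i* b)%C by simpc.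
exact: cmodD.
Qed.

Lemma normr_Re_le z : `|complex.Re z| <= cmod z.
Proof. by rewrite -lecR cmodE normc_ge_Re. Qed.

Lemma normr_Im_le z : `|complex.Im z| <= cmod z.
Proof.
case: z => a b /=; rewrite /cmod normc_def /= -[leLHS]sqrtr_sqr ler_wsqrtr//.
by rewrite lerDr sqr_ge0.
Qed.

(** Radii of complex balls are positive complex numbers, that is, positive reals;
this criterion replaces them by elements of [R]. *)
Lemma complex_nbhsP (T : Type) (f : T -> R[i]^o) (F : set_system T)
    (FF : Filter F) (l : R[i]^o) :
  f @ F --> l <-> forall e : R, 0 < e -> \forall t \near F, cmod (l - f t) < e.
Proof.
split=> [/cvgrPdist_lt H e e0|H].
  have /H : 0 < e%:C%C by rewrite ltcR.
  by apply: filterS => t; rewrite -cmodE ltcR.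
apply/cvgrPdist_lt => e; rewrite ltcE /= => /andP[/eqP e0 ere].
have -> : e = (complex.Re e)%:C%C by case: e e0 {ere} => a b /= ->.
by apply: filterS (H _ ere) => t; rewrite -cmodE ltcR.
Qed.

Lemma ReB z w : complex.Re (z - w) = complex.Re z - complex.Re w.
Proof. by case: z w => a b []. Qed.

Lemma ImB z w : complex.Im (z - w) = complex.Im z - complex.Im w.
Proof. by case: z w => a b []. Qed.

Lemma cvg_complexP (T : Type) (f : T -> R[i]^o) (F : set_system T)
    (FF : Filter F) (l : R[i]^o) :
  f @ F --> l <-> (complex.Re (f t) @[t --> F] --> complex.Re l /\
                   complex.Im (f t) @[t --> F] --> complex.Im l).
Proof.
split=> [/complex_nbhsP H|[cr ci]].
  split; apply/cvgrPdist_lt => e e0; have := H e e0; apply: filterS => t;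
    apply: le_lt_trans.
    by rewrite -ReB normr_Re_le.
  by rewrite -ImB normr_Im_le.
apply/complex_nbhsP => e e0; have e20 : 0 < e / 2 by rewrite divr_gt0.
near=> t.
rewrite (splitr e) (le_lt_trans (cmod_le_ReIm _))// ReB ImB ltrD//; near: t.
  by move/cvgrPdist_lt : cr => /(_ _ e20).
by move/cvgrPdist_lt : ci => /(_ _ e20).
Unshelve. all: by end_near. Qed.

Lemma continuous_complexP (T : topologicalType) (f : T -> R[i]^o) :
  continuous f <-> continuous (fun t => complex.Re (f t)) /\
                   continuous (fun t => complex.Im (f t)).
Proof.
split=> [cf|[cr ci] t]; last by apply/cvg_complexP; split; [exact: cr|exact: ci].
by split=> t; have /cvg_complexP[] := cf t.
Qed.

End ComplexModulus.

(** * Characters of the torus *)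
Section Frequencies.
Context {R : realType} {s : nat}.
Implicit Types (x : 'rV[R]_s) (eta : 'rV[int]_s) (k : 'I_s).

Lemma dotZ_translate x eta (c : R) k :
  dotZ (x + c *: delta_mx 0 k) eta = dotZ x eta + c * (eta 0 k)%:~R.
Proof.
rewrite /dotZ (bigD1 k)//= [in RHS](bigD1 k)//= !mxE !eqxx mulr1 mulrDl addrAC.
congr (_ + _); congr (_ + _); apply: eq_bigr => i ik.
by rewrite !mxE (negbTE ik) andbF mulr0 addr0.
Qed.

Lemma continuous_dotZ eta : continuous (fun x => dotZ x eta).
Proof.
rewrite /dotZ; elim: (index_enum _) => [|i l IH].
  by under eq_fun do rewrite big_nil; exact: cst_continuous.
under eq_fun do rewrite big_cons.
apply: rcontinuousD IH; apply: rcontinuousM; last exact: cst_continuous.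
exact: coord_continuous.
Qed.

Lemma periodicz (f : R -> R) (T : R) : periodic f T ->
  forall (n : int) a, f (a + T * n%:~R) = f a.
Proof.
move=> pf [n|n] a; rewrite mulrzr; first exact: periodicn.
rewrite NegzE mulrNz -[T *~ _]/(T *+ n.+1).
by rewrite -(periodicn pf n.+1) subrK.
Qed.

Lemma trig_dotZ_periodic (f : R -> R) x eta k : periodic f (pi *+ 2) ->
  f (dotZ (x + (2 * pi) *: delta_mx 0 k) eta) = f (dotZ x eta).
Proof. by move=> pf; rewrite dotZ_translate mulr_natl periodicz. Qed.

(** Along the k-th axis the phase moves with constant speed eta_k. *)
Lemma is_derive_dotZ (f : R -> R) (d : R) x eta k :
  is_derive (dotZ x eta) 1 f d ->
  is_derive x (delta_mx 0 k) (fun x => f (dotZ x eta)) ((eta 0 k)%:~R * d).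
Proof.
move=> fd; have /derivable1_diffP df : derivable f (dotZ x eta) 1 by case: fd.
refine (is_derive_affine (v := (eta 0 k)%:~R : R) (g := fun x => dotZ x eta) _ _).
  by move=> h; rewrite addrC dotZ_translate addrC.
split; first exact: diff_derivable.
rewrite deriveE// -[(eta 0 k)%:~R]mulr1 -[X in 'd f _ X]/((eta 0 k)%:~R *: (1 : R)).
by rewrite linearZ/= -deriveE//; case: fd => _ ->; rewrite mulr1.
Qed.

End Frequencies.

(** * Integrals over the second group of variables *)
Section SliceIntegral.
Context {R : realType} {r s : nat}.
Implicit Types (p q dp dq : 'rV[R]_(r + s) -> R) (a b da db : 'rV[R]_s -> R) (t : 'rV[R]_r).

(** The real and the imaginary part of a partial Fourier coefficient both have
this shape, with p and q the real and imaginary part of the function and a, b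
a pair of trigonometric functions of the phase. *)
Definition slice_integral p q a b t : R :=
  torus_integral (fun x => a x * p (row_mx t x) + b x * q (row_mx t x)).

Lemma continuous_slice_integrand (T : topologicalType) (g : T -> 'rV[R]_r) p q a b :
  continuous g -> continuous p -> continuous q -> continuous a -> continuous b ->
  continuous (fun z : T * 'rV[R]_s =>
    a z.2 * p (row_mx (g z.1) z.2) + b z.2 * q (row_mx (g z.1) z.2)).
Proof.
move=> cg cp cq ca cb.
have c1 : continuous (fun z : T * 'rV[R]_s => g z.1).
  by move=> z; apply: (@continuous_comp _ _ _ fst g); [exact: cvg_fst|exact: cg].
have c2 : continuous (fun z : T * 'rV[R]_s => z.2) by move=> z; exact: cvg_snd.
have crow := continuous_row_mx c1 c2.
apply: rcontinuousD; apply: rcontinuousM.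
- exact: (rcontinuous_comp ca c2).
- exact: (rcontinuous_comp cp crow).
- exact: (rcontinuous_comp cb c2).
- exact: (rcontinuous_comp cq crow).
Qed.

Lemma continuous_slice_integrandx p q a b t :
  continuous p -> continuous q -> continuous a -> continuous b ->
  continuous (fun x : 'rV[R]_s => a x * p (row_mx t x) + b x * q (row_mx t x)).
Proof.
move=> cp cq ca cb; have cid : continuous (@id 'rV[R]_r) by move=> x; exact: cvg_id.
exact: (continuous_slice (continuous_slice_integrand cid cp cq ca cb) (t := t)).
Qed.

Lemma continuous_slice_integral p q a b :
  continuous p -> continuous q -> continuous a -> continuous b ->
  continuous (slice_integral p q a b).
Proof.
move=> cp cq ca cb; have cid : continuous (@id 'rV[R]_r) by move=> x; exact: cvg_id.
exact: (continuous_torus_integral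
  (G := fun t x => a x * p (row_mx t x) + b x * q (row_mx t x))
  (continuous_slice_integrand cid cp cq ca cb)).
Qed.

Lemma is_derive_slice_integral p q dp dq a b (i : 'I_r) t :
  continuous p -> continuous q -> continuous dp -> continuous dq ->
  continuous a -> continuous b ->
  (forall y, is_derive y (delta_mx 0 (lshift s i)) p (dp y)) ->
  (forall y, is_derive y (delta_mx 0 (lshift s i)) q (dq y)) ->
  is_derive t (delta_mx 0 i) (slice_integral p q a b) (slice_integral dp dq a b t).
Proof.
move=> cp cq cdp cdq ca cb pd qd; apply: is_derive_line.
pose line (h : R) : 'rV[R]_r := h *: delta_mx 0 i + t.
have cline : continuous line.
  move=> h; apply: cvgD; last exact: cvg_cst.
  by apply: cvgZr_tmp; exact: cvg_id.
have line0 : line 0 = t by rewrite /line scale0r add0r.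
rewrite -[X in slice_integral dp dq a b X]line0.
apply: (is_derive_torus_integral
  (G := fun h x => a x * p (row_mx (line h) x) + b x * q (row_mx (line h) x))
  (dG := fun h x => a x * dp (row_mx (line h) x) + b x * dq (row_mx (line h) x))).
- exact: continuous_slice_integrand.
- exact: continuous_slice_integrand.
move=> h x.
have lineE k : row_mx (line (k *: (1 : R) + h)) x =
    k *: delta_mx 0 (lshift s i) + row_mx (line h) x.
  rewrite [RHS]addrC row_mx_translatel /line -[k%:A]/(k * 1) mulr1 scalerDl.
  by congr row_mx; rewrite addrC addrA addrC addrA.
have line_derive (f df : 'rV[R]_(r + s) -> R) :
    (forall y, is_derive y (delta_mx 0 (lshift s i)) f (df y)) ->
    is_derive h 1 (fun h => f (row_mx (line h) x)) (df (row_mx (line h) x)).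
  move=> fd; exact: (is_derive_affine (q := h) (u := 1)
    (g := fun h => row_mx (line h) x) lineE (fd (row_mx (line h) x))).
by apply: is_deriveD; apply: is_derive_scale; exact: line_derive.
Qed.

(** The derivative of the whole integrand along a periodic direction integrates
to zero, and the product rule splits it into the two sides. *)
Lemma slice_integral_by_parts p q dp dq a b da db (k : 'I_s) t :
  continuous p -> continuous q -> continuous dp -> continuous dq ->
  continuous a -> continuous b -> continuous da -> continuous db ->
  (forall y, is_derive y (delta_mx 0 (rshift r k)) p (dp y)) ->
  (forall y, is_derive y (delta_mx 0 (rshift r k)) q (dq y)) ->
  (forall x, is_derive x (delta_mx 0 k) a (da x)) ->
  (forall x, is_derive x (delta_mx 0 k) b (db x)) ->
  (forall y, p (y + (2 * pi) *: delta_mx 0 (rshift r k)) = p y) ->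
  (forall y, q (y + (2 * pi) *: delta_mx 0 (rshift r k)) = q y) ->
  (forall x, a (x + (2 * pi) *: delta_mx 0 k) = a x) ->
  (forall x, b (x + (2 * pi) *: delta_mx 0 k) = b x) ->
  slice_integral dp dq a b t = - slice_integral p q da db t.
Proof.
move=> cp cq cdp cdq ca cb cda cdb pd qd ad bd pp qp ap bp.
apply/eqP; rewrite -addr_eq0 /slice_integral -torus_integralD; last 2 first.
  exact: continuous_slice_integrandx.
  exact: continuous_slice_integrandx.
apply/eqP; apply: (@torus_integral_periodic_derivative R s
  (fun x => a x * p (row_mx t x) + b x * q (row_mx t x)) _ k).
- exact: continuous_slice_integrandx.
- by apply: rcontinuousD; exact: continuous_slice_integrandx.
- move=> x.
  have lineE h : row_mx t (h *: delta_mx 0 k + x) =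
      h *: delta_mx 0 (rshift r k) + row_mx t x.
    by rewrite [RHS]addrC row_mx_translater addrC.
  have row_derive (f df : 'rV[R]_(r + s) -> R) :
      (forall y, is_derive y (delta_mx 0 (rshift r k)) f (df y)) ->
      is_derive x (delta_mx 0 k) (fun x => f (row_mx t x)) (df (row_mx t x)).
    move=> fd; exact: (is_derive_affine (q := x) (u := delta_mx 0 k)
      (g := fun x => row_mx t x) lineE (fd (row_mx t x))).
  rewrite addrACA.
  apply: is_deriveD.
    refine (is_derive_eq (is_deriveM (ad x) (row_derive _ _ pd)) _).
    by rewrite /GRing.scale/= [da x * _]mulrC.
  refine (is_derive_eq (is_deriveM (bd x) (row_derive _ _ qd)) _).
  by rewrite /GRing.scale/= [db x * _]mulrC.
- by move=> x; rewrite ap bp -row_mx_translater pp qp.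
Qed.

Lemma slice_integral_le p q a b t (B : R) :
  continuous p -> continuous q -> continuous a -> continuous b ->
  (forall y, `|p y| <= B) -> (forall y, `|q y| <= B) ->
  (forall x, `|a x| <= 1) -> (forall x, `|b x| <= 1) ->
  `|slice_integral p q a b t| <= (2 * pi) ^+ s * (B + B).
Proof.
move=> cp cq ca cb pB qB a1 b1; apply: torus_integral_le.
  exact: continuous_slice_integrandx.
move=> x _; rewrite (le_trans (ler_normD _ _))// lerD// normrM -[B]mul1r ler_pM//.
Qed.

Lemma slice_integralZ p q a b t (c : R) :
  continuous p -> continuous q -> continuous a -> continuous b ->
  slice_integral p q (fun x => c * a x) (fun x => c * b x) t =
  c * slice_integral p q a b t.
Proof.
move=> cp cq ca cb; rewrite /slice_integral -torus_integralZ.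
- by congr torus_integral; apply/funext => x; rewrite mulrDr !mulrA.
- exact: continuous_slice_integrandx.
Qed.

End SliceIntegral.

(** * Smooth functions on the torus *)
Section PartialDerivatives.
Context {R : realType} {d : nat}.
Implicit Types (f g : complex_fun R d) (i : 'I_d).

(** The relational form of the pair [pderivable], [pderive]: it lets the
derivation rules of the real and imaginary parts be chained. *)
Definition is_pderive i f g : Prop := forall x,
  is_derive x (delta_mx 0 i) (fun y => complex.Re (f y)) (complex.Re (g x)) /\
  is_derive x (delta_mx 0 i) (fun y => complex.Im (f y)) (complex.Im (g x)).

Lemma is_pderiveP i f g : is_pderive i f g <-> pderivable i f /\ pderive i f = g.
Proof.
split=> [H|[fd <-] x].
  split=> [x|]; first by case: (H x) => -[? _] [].
  by apply/funext => x; case: (H x) => -[_ e1] [_ e2]; rewrite /pderive e1 e2; case: (g x).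
by case: (fd x) => f1 f2; split; exact: derivableP.
Qed.

Lemma is_pderive_lin (a : R[i]) i f f' g g' :
  is_pderive i f f' -> is_pderive i g g' ->
  is_pderive i (a *: f + g) (a *: f' + g').
Proof.
move=> Hf Hg x; case: (Hf x) => f1 f2; case: (Hg x) => g1 g2; case: a => a b.
have ReE (u v : complex_fun R d) y : complex.Re (((a +i* b)%C *: u + v) y) =
    (a * complex.Re (u y) + - b * complex.Im (u y)) + complex.Re (v y).
  by rewrite -[((_ : complex_fun R d) + _) y]/((a +i* b)%C * u y + v y);
    case: (u y) (v y) => ? ? [? ?] /=; rewrite mulNr.
have ImE (u v : complex_fun R d) y : complex.Im (((a +i* b)%C *: u + v) y) =
    (a * complex.Im (u y) + b * complex.Re (u y)) + complex.Im (v y).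
  by rewrite -[((_ : complex_fun R d) + _) y]/((a +i* b)%C * u y + v y);
    case: (u y) (v y) => ? ? [? ?].
rewrite ReE ImE; split.
  under eq_fun do rewrite ReE.
  by apply: is_deriveD => //; apply: is_deriveD; exact: is_derive_scale.
under eq_fun do rewrite ImE.
by apply: is_deriveD => //; apply: is_deriveD; exact: is_derive_scale.
Qed.

Lemma continuous_lin (a : R[i]) f g : continuous f -> continuous g ->
  continuous (a *: f + g).
Proof.
by move=> cf cg x; exact: (cvgD (cvgZl_tmp (k := a) (cf x)) (cg x)).
Qed.

Lemma Ck_lin k (a : R[i]) f g : Ck k f -> Ck k g -> Ck k (a *: f + g).
Proof.
elim: k f g => [|k IH] f g /=; first exact: continuous_lin.
move=> [cf Hf] [cg Hg]; split; first exact: continuous_lin.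
move=> i; case: (Hf i) => fd kf; case: (Hg i) => gd kg.
have /is_pderiveP Pf : pderivable i f /\ pderive i f = pderive i f by [].
have /is_pderiveP Pg : pderivable i g /\ pderive i g = pderive i g by [].
have /is_pderiveP[? ->] := is_pderive_lin a Pf Pg.
by split=> //; exact: IH.
Qed.

Lemma smooth_torus_continuous f : smooth_torus f -> continuous f.
Proof. by move=> [_ /(_ 0)]. Qed.

Lemma smooth_torus_is_pderive i f : smooth_torus f -> is_pderive i f (pderive i f).
Proof. by move=> [_ /(_ 1)[_ /(_ i)[? _]]]; apply/is_pderiveP. Qed.

Lemma smooth_torus_lin (a : R[i]) f g :
  smooth_torus f -> smooth_torus g -> smooth_torus (a *: f + g).
Proof.
move=> [pf kf] [pg kg]; split=> [i x|k]; last exact: Ck_lin.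
by rewrite -![((_ : complex_fun R d) + _) _]/(a * f _ + g _) pf pg.
Qed.

(** A multiple is written as (a - 1) f + f, so that linear combinations of this
one form suffice; the same device serves the other scaling rules below. *)
Lemma smooth_torusZ (a : R[i]) f : smooth_torus f -> smooth_torus (a *: f).
Proof.
move=> sf; rewrite -(subrK 1 a) scalerDl scale1r.
exact: smooth_torus_lin.
Qed.

(** Translating by a period leaves the difference quotients unchanged, so the
derivative inherits the period. *)
Lemma is_derive_periodic (f : 'rV[R]_d -> R) (x v w : 'rV[R]_d) (l l' : R) :
  (forall y, f (y + w) = f y) -> is_derive x v f l -> is_derive (x + w) v f l' ->
  l' = l.
Proof.
move=> fw fl [_ <-].
case: fl => _ <-; rewrite /derive.
suff -> : (fun h : R => h^-1 *: ((f \o shift (x + w)) (h *: v) - f (x + w))) =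
    (fun h : R => h^-1 *: ((f \o shift x) (h *: v) - f x)) by [].
by apply/funext => h /=; rewrite addrA !fw.
Qed.

Lemma smooth_torus_pderive i f : smooth_torus f -> smooth_torus (pderive i f).
Proof.
move=> sf; split; last by move=> k; case: sf => _ /(_ k.+1) [_ /(_ i)[]].
have fd := smooth_torus_is_pderive i sf.
move=> j x.
case: (fd x) => f1 f2; case: (fd (x + (2 * pi) *: delta_mx 0 j)) => f3 f4.
case: sf => pf _.
have /eqP er := is_derive_periodic (fun y => congr1 (@complex.Re R) (pf j y)) f1 f3.
have /eqP ei := is_derive_periodic (fun y => congr1 (@complex.Im R) (pf j y)) f2 f4.
by apply/eqP; rewrite eq_complex er ei.
Qed.

Lemma DopE i f : Dop i f = (0 -i* 1)%C *: pderive i f.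
Proof. by []. Qed.

Lemma smooth_torus_Dop i f : smooth_torus f -> smooth_torus (Dop i f).
Proof. by move=> sf; rewrite DopE; apply: smooth_torusZ; exact: smooth_torus_pderive. Qed.

Lemma Dop_lin i (a : R[i]) f g : smooth_torus f -> smooth_torus g ->
  Dop i (a *: f + g) = a *: Dop i f + Dop i g.
Proof.
move=> /(smooth_torus_is_pderive i) Pf /(smooth_torus_is_pderive i) Pg.
have /is_pderiveP[_ E] := is_pderive_lin a Pf Pg.
by rewrite !DopE E scalerDr !scalerA mulrC.
Qed.

End PartialDerivatives.

(** * Partial Fourier coefficients *)
Section PartialFourierCoefficient.
Context {R : realType} {r s : nat}.
Implicit Types (lam dlam mu : complex_fun R (r + s)) (eta : 'rV[int]_s) (t : 'rV[R]_r).

(** The function of t that [tensor_exp] feeds to its first argument. *)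
Definition fourier_coef eta lam : complex_fun R r := fun t =>
  int_torus (fun x => lam (row_mx t x) * expi (dotZ x eta)).

Lemma int_torusE n (f : 'rV[R]_n -> R[i]) :
  int_torus f = (torus_integral (fun x => complex.Re (f x))
                 +i* torus_integral (fun x => complex.Im (f x)))%C.
Proof.
elim: n f => [|n IH] f /=; first by case: (f 0).
by rewrite /int_circle; congr Complex; apply: eq_Rintegral => a _; rewrite IH.
Qed.

Lemma fourier_coefE eta lam t : fourier_coef eta lam t =
  (slice_integral (fun y => complex.Re (lam y)) (fun y => complex.Im (lam y))
     (fun x => cos (dotZ x eta)) (fun x => - sin (dotZ x eta)) t
   +i* slice_integral (fun y => complex.Re (lam y)) (fun y => complex.Im (lam y))
     (fun x => sin (dotZ x eta)) (fun x => cos (dotZ x eta)) t)%C.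
Proof.
rewrite /fourier_coef int_torusE; congr Complex; congr torus_integral.
  by apply/funext => x; case: (lam _) => a b /=; ring.
by apply/funext => x; case: (lam _) => a b /=; ring.
Qed.

Lemma continuous_cos_dotZ eta : continuous (fun x : 'rV[R]_s => cos (dotZ x eta)).
Proof. exact: (rcontinuous_comp (@continuous_cos R) (@continuous_dotZ R s eta)). Qed.

Lemma continuous_sin_dotZ eta : continuous (fun x : 'rV[R]_s => sin (dotZ x eta)).
Proof. exact: (rcontinuous_comp (@continuous_sin R) (@continuous_dotZ R s eta)). Qed.

Lemma continuous_Nsin_dotZ eta : continuous (fun x : 'rV[R]_s => - sin (dotZ x eta)).
Proof. exact/rcontinuousN/continuous_sin_dotZ. Qed.

Let ccos := continuous_cos_dotZ.
Let csin := continuous_sin_dotZ.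
Let cNsin := continuous_Nsin_dotZ.

Lemma continuous_fourier_coef eta lam :
  continuous lam -> continuous (fourier_coef eta lam).
Proof.
move=> /continuous_complexP[cr ci]; apply/continuous_complexP; split.
  under eq_fun do rewrite fourier_coefE /=.
  exact: continuous_slice_integral.
under eq_fun do rewrite fourier_coefE /=.
exact: continuous_slice_integral.
Qed.

Lemma continuous_fourier_integrand eta lam t : continuous lam ->
  continuous (fun x : 'rV[R]_s => lam (row_mx t x) * expi (dotZ x eta) : R[i]^o).
Proof.
move=> /continuous_complexP[cr ci]; apply/continuous_complexP; split.
  rewrite (_ : (fun _ => _) = fun x => cos (dotZ x eta) * complex.Re (lam (row_mx t x)) +
      - sin (dotZ x eta) * complex.Im (lam (row_mx t x))).
    exact: (@continuous_slice_integrandx R r s (fun y => complex.Re (lam y))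
      (fun y => complex.Im (lam y)) _ _ t).
  by apply/funext => x; case: (lam _) => a b /=; ring.
rewrite (_ : (fun _ => _) = fun x => sin (dotZ x eta) * complex.Re (lam (row_mx t x)) +
    cos (dotZ x eta) * complex.Im (lam (row_mx t x))).
  exact: (@continuous_slice_integrandx R r s (fun y => complex.Re (lam y))
      (fun y => complex.Im (lam y)) _ _ t).
by apply/funext => x; case: (lam _) => a b /=; ring.
Qed.

Lemma int_torus_lin n (c : R[i]) (f g : 'rV[R]_n -> R[i]^o) :
  continuous f -> continuous g ->
  int_torus (fun x => c * f x + g x) = c * int_torus f + int_torus g.
Proof.
move=> /continuous_complexP[fr fi] /continuous_complexP[gr gi].
rewrite !int_torusE; case: c => a b.
have E1 : (fun x => complex.Re ((a +i* b)%C * f x + g x)) =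
    (fun x => (a * complex.Re (f x) + - b * complex.Im (f x)) + complex.Re (g x)).
  by apply/funext => x; case: (f x) (g x) => ? ? [? ?] /=; rewrite mulNr.
have E2 : (fun x => complex.Im ((a +i* b)%C * f x + g x)) =
    (fun x => (a * complex.Im (f x) + b * complex.Re (f x)) + complex.Im (g x)).
  by apply/funext => x; case: (f x) (g x) => ? ? [].
have Zr c := rcontinuousZ (c := c) fr; have Zi c := rcontinuousZ (c := c) fi.
rewrite E1 E2 !torus_integralD ?torus_integralZ//.
- by rewrite mulNr.
- exact: rcontinuousD.
- exact: rcontinuousD.
Qed.

Lemma fourier_coef_lin eta (c : R[i]) lam mu : continuous lam -> continuous mu ->
  fourier_coef eta (c *: lam + mu) = c *: fourier_coef eta lam + fourier_coef eta mu.
Proof.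
move=> cl cm; apply/funext => t.
rewrite -[RHS]/(c * fourier_coef eta lam t + fourier_coef eta mu t) /fourier_coef.
rewrite -(int_torus_lin c (@continuous_fourier_integrand eta lam t cl)
  (@continuous_fourier_integrand eta mu t cm)).
by congr int_torus; apply/funext => x; rewrite mulrA -mulrDl.
Qed.

Lemma is_pderive_fourier_coef eta (i : 'I_r) lam dlam :
  continuous lam -> continuous dlam -> is_pderive (lshift s i) lam dlam ->
  is_pderive i (fourier_coef eta lam) (fourier_coef eta dlam).
Proof.
move=> /continuous_complexP[cr ci] /continuous_complexP[cdr cdi] H t.
have Hr y := proj1 (H y); have Hi y := proj2 (H y).
rewrite [X in complex.Re X]fourier_coefE [X in complex.Im X]fourier_coefE /=; split.
  under eq_fun do rewrite fourier_coefE /=.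
  exact: is_derive_slice_integral.
under eq_fun do rewrite fourier_coefE /=.
exact: is_derive_slice_integral.
Qed.

(** Differentiating cos and sin of the phase exchanges them up to sign and brings
down the factor eta_k; on the complex level this is multiplication by
- i eta_k. *)
Lemma fourier_coef_by_parts eta (k : 'I_s) lam dlam :
  continuous lam -> continuous dlam -> periodic2pi lam ->
  is_pderive (rshift r k) lam dlam ->
  fourier_coef eta dlam = (0 -i* (eta 0 k)%:~R)%C *: fourier_coef eta lam.
Proof.
move=> /continuous_complexP[cr ci] /continuous_complexP[cdr cdi] per H.
apply/funext => t.
have Hr y := proj1 (H y); have Hi y := proj2 (H y).
rewrite -[RHS]/((0 -i* (eta 0 k)%:~R)%C * fourier_coef eta lam t) !fourier_coefE.
pose c : R := (eta 0 k)%:~R.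
have dsin x : is_derive x (delta_mx 0 k) (fun x : 'rV[R]_s => sin (dotZ x eta))
    (c * cos (dotZ x eta)).
  exact: is_derive_dotZ.
have dcos x : is_derive x (delta_mx 0 k) (fun x : 'rV[R]_s => cos (dotZ x eta))
    (c * - sin (dotZ x eta)).
  exact: is_derive_dotZ.
have dcos' x : is_derive x (delta_mx 0 k) (fun x : 'rV[R]_s => cos (dotZ x eta))
    (- c * sin (dotZ x eta)).
  by rewrite mulNr -mulrN; exact: dcos.
have dNsin x : is_derive x (delta_mx 0 k) (fun x : 'rV[R]_s => - sin (dotZ x eta))
    (- c * cos (dotZ x eta)).
  by rewrite mulNr; exact: (is_deriveN (dsin x)).
have pr y :
    complex.Re (lam (y + (2 * pi) *: delta_mx 0 (rshift r k))) = complex.Re (lam y).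
  by rewrite per.
have pim y :
    complex.Im (lam (y + (2 * pi) *: delta_mx 0 (rshift r k))) = complex.Im (lam y).
  by rewrite per.
have psin (x : 'rV[R]_s) := trig_dotZ_periodic x eta k (@sinD2pi R).
have pcos (x : 'rV[R]_s) := trig_dotZ_periodic x eta k (@cosD2pi R).
have pNsin (x : 'rV[R]_s) :
    - sin (dotZ (x + (2 * pi) *: delta_mx 0 k) eta) = - sin (dotZ x eta).
  by rewrite psin.
rewrite (@slice_integral_by_parts R r s _ _ _ _ _ _ _ _ k t cr ci cdr cdi
  (@ccos eta) (@cNsin eta)
  (@rcontinuousZ _ _ _ (- c) (@csin eta)) (@rcontinuousZ _ _ _ (- c) (@ccos eta))
  Hr Hi dcos' dNsin pr pim pcos pNsin).
rewrite (@slice_integral_by_parts R r s _ _ _ _ _ _ _ _ k t cr ci cdr cdi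
  (@csin eta) (@ccos eta)
  (@rcontinuousZ _ _ _ c (@ccos eta)) (@rcontinuousZ _ _ _ c (@cNsin eta))
  Hr Hi dsin dcos pr pim psin pcos).
rewrite !slice_integralZ//; rewrite -/c; apply/eqP; rewrite eq_complex /=.
by apply/andP; split; apply/eqP; ring.
Qed.

End PartialFourierCoefficient.

(** * Higher derivatives of partial Fourier coefficients *)
Section IteratedDerivatives.
Context {R : realType} {d : nat}.
Implicit Types (f : complex_fun R d) (al : 'I_d -> nat) (l : seq 'I_d).

(** [Dalpha] with a free list of directions in place of the enumeration of all
of them, so that it can be split and reasoned about by induction. *)
Definition iter_Dop al l f : complex_fun R d :=
  foldr (fun i g => iter (al i) (Dop i) g) f l.

Lemma smooth_torus_iter i n f : smooth_torus f -> smooth_torus (iter n (Dop i) f).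
Proof. by move=> sf; elim: n => //= n; exact: smooth_torus_Dop. Qed.

Lemma smooth_torus_iter_Dop al l f : smooth_torus f -> smooth_torus (iter_Dop al l f).
Proof. by move=> sf; elim: l => //= i l; exact: smooth_torus_iter. Qed.

Lemma smooth_torus_Dalpha (alpha : {ffun 'I_d -> nat}) f :
  smooth_torus f -> smooth_torus (Dalpha alpha f).
Proof. exact: smooth_torus_iter_Dop. Qed.

Lemma iter_Dop_lin al l (c : R[i]) f g : smooth_torus f -> smooth_torus g ->
  iter_Dop al l (c *: f + g) = c *: iter_Dop al l f + iter_Dop al l g.
Proof.
move=> sf sg; elim: l => //= i l ->.
have := smooth_torus_iter_Dop al l sf; have := smooth_torus_iter_Dop al l sg.
move: (iter_Dop al l f) (iter_Dop al l g) => {}f {}g {}sg {}sf.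
elim: (al i) => //= n ->; rewrite Dop_lin//; exact: smooth_torus_iter.
Qed.

Lemma Dalpha_lin (alpha : {ffun 'I_d -> nat}) (c : R[i]) f g :
  smooth_torus f -> smooth_torus g ->
  Dalpha alpha (c *: f + g) = c *: Dalpha alpha f + Dalpha alpha g.
Proof. exact: iter_Dop_lin. Qed.

Lemma iter_DopZ al l (c : R[i]) f : smooth_torus f ->
  iter_Dop al l (c *: f) = c *: iter_Dop al l f.
Proof.
move=> sf; rewrite -[in LHS](subrK 1 c) scalerDl scale1r iter_Dop_lin//.
by rewrite -[X in _ + X]scale1r -scalerDl subrK.
Qed.

Lemma iter_Dop_single k al l f : k \in l -> uniq l ->
  {in l, forall i, i != k -> al i = 0%N} -> iter_Dop al l f = iter (al k) (Dop k) f.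
Proof.
move=> kl ul al0.
suff {kl} : iter_Dop al l f = if k \in l then iter (al k) (Dop k) f else f by rewrite kl.
elim: l ul al0 => //= i l IH /andP[il ul] al0; rewrite IH//; last first.
  by move=> j jl; apply: al0; rewrite in_cons jl orbT.
rewrite in_cons; have [ki|ki] := eqVneq k i.
  by rewrite -ki in il *; rewrite (negbTE il).
by rewrite (al0 i) ?mem_head// eq_sym.
Qed.

End IteratedDerivatives.

Section FourierCoefficientDerivatives.
Context {R : realType} {r s : nat}.
Implicit Types (lam : complex_fun R (r + s)) (eta : 'rV[int]_s) (t : 'rV[R]_r).

Lemma fourier_coefZ eta (c : R[i]) lam : continuous lam ->
  fourier_coef eta (c *: lam) = c *: fourier_coef eta lam.
Proof.
move=> cl; rewrite -[in LHS](subrK 1 c) scalerDl scale1r fourier_coef_lin//.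
by rewrite -[X in _ + X]scale1r -scalerDl subrK.
Qed.

Lemma cmod_fourier_coef_le eta lam (B : R) t : continuous lam ->
  (forall y, cmod (lam y) <= B) ->
  cmod (fourier_coef eta lam t) <= 4 * (2 * pi) ^+ s * B.
Proof.
move=> /continuous_complexP[cr ci] lB.
rewrite fourier_coefE (le_trans (cmod_le_ReIm _))//=.
have rB y : `|complex.Re (lam y)| <= B := le_trans (normr_Re_le _) (lB y).
have iB y : `|complex.Im (lam y)| <= B := le_trans (normr_Im_le _) (lB y).
have c1 (x : 'rV[R]_s) : `|cos (dotZ x eta)| <= 1 by rewrite ler_norml cos_geN1 cos_le1.
have s1 (x : 'rV[R]_s) : `|sin (dotZ x eta)| <= 1 by rewrite ler_norml sin_geN1 sin_le1.
have s1' (x : 'rV[R]_s) : `|- sin (dotZ x eta)| <= 1 by rewrite normrN.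
have -> : 4 * (2 * pi) ^+ s * B = (2 * pi) ^+ s * (B + B) + (2 * pi) ^+ s * (B + B).
  by ring.
apply: lerD; apply: slice_integral_le => //.
- exact: continuous_cos_dotZ.
- exact: continuous_Nsin_dotZ.
- exact: continuous_sin_dotZ.
- exact: continuous_cos_dotZ.
Qed.

Lemma pderive_fourier_coef eta (i : 'I_r) lam : smooth_torus lam ->
  is_pderive i (fourier_coef eta lam) (fourier_coef eta (pderive (lshift s i) lam)).
Proof.
move=> sl; apply: is_pderive_fourier_coef; first exact: smooth_torus_continuous.
  by apply: smooth_torus_continuous; exact: smooth_torus_pderive.
exact: smooth_torus_is_pderive.
Qed.

Lemma smooth_torus_fourier_coef eta lam :
  smooth_torus lam -> smooth_torus (fourier_coef eta lam).
Proof.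
move=> sl; split=> [i t|k].
  rewrite /fourier_coef; congr int_torus; apply/funext => x.
  by rewrite -row_mx_translatel; case: sl => ->.
elim: k lam sl => [|k IH] lam sl /=.
  by apply: continuous_fourier_coef; exact: smooth_torus_continuous.
split; first by apply: continuous_fourier_coef; exact: smooth_torus_continuous.
move=> i; have /is_pderiveP[? ->] := pderive_fourier_coef eta i sl.
by split=> //; apply: IH; exact: smooth_torus_pderive.
Qed.

Lemma Dop_fourier_coef eta (i : 'I_r) lam : smooth_torus lam ->
  Dop i (fourier_coef eta lam) = fourier_coef eta (Dop (lshift s i) lam).
Proof.
move=> sl; have /is_pderiveP[_ E] := pderive_fourier_coef eta i sl.
rewrite !DopE E fourier_coefZ//.
by apply: smooth_torus_continuous; exact: smooth_torus_pderive.
Qed.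

(** The factor - i in the definition of D turns - i eta_k into - eta_k. *)
Lemma fourier_coef_Dop eta (k : 'I_s) lam : smooth_torus lam ->
  fourier_coef eta (Dop (rshift r k) lam) =
  ((- (eta 0 k)%:~R)%:C)%C *: fourier_coef eta lam.
Proof.
move=> sl; have cl := smooth_torus_continuous sl.
have cd := smooth_torus_continuous (smooth_torus_pderive (rshift r k) sl).
rewrite DopE fourier_coefZ//.
rewrite (fourier_coef_by_parts eta cl cd (proj1 sl) (smooth_torus_is_pderive _ sl)).
by rewrite scalerA; congr (_ *: _); simpc.
Qed.

Lemma fourier_coef_iter_Dop eta (k : 'I_s) n lam : smooth_torus lam ->
  fourier_coef eta (iter n (Dop (rshift r k)) lam) =
  ((- (eta 0 k)%:~R)%:C)%C ^+ n *: fourier_coef eta lam.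
Proof.
move=> sl; elim: n => [|n IH] /=; first by rewrite expr0 scale1r.
by rewrite fourier_coef_Dop ?IH ?scalerA -?exprS//; exact: smooth_torus_iter.
Qed.

Lemma iter_Dop_fourier_coef eta (al : 'I_(r + s) -> nat) (l : seq 'I_r) lam :
  smooth_torus lam ->
  iter_Dop (fun i => al (lshift s i)) l (fourier_coef eta lam) =
  fourier_coef eta (iter_Dop al (map (@lshift r s) l) lam).
Proof.
move=> sl; elim: l => //= i l ->.
have := smooth_torus_iter_Dop al (map (@lshift r s) l) sl.
move: (iter_Dop _ _ lam) => mu sm; elim: (al _) => //= n ->.
by rewrite Dop_fourier_coef//; exact: smooth_torus_iter.
Qed.

(** The multi-index (alpha, p e_k) on the product torus. *)
Definition join_index (alpha : {ffun 'I_r -> nat}) (k : 'I_s) (p : nat) :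
    {ffun 'I_(r + s) -> nat} :=
  [ffun j => match fintype.split j with
             | inl i => alpha i
             | inr k' => if k' == k then p else 0%N
             end].

Lemma join_indexl alpha k p i : join_index alpha k p (lshift s i) = alpha i.
Proof. by rewrite ffunE (unsplitK (inl i)). Qed.

Lemma join_indexr alpha k p k' :
  join_index alpha k p (rshift r k') = if k' == k then p else 0%N.
Proof. by rewrite ffunE (unsplitK (inr k')). Qed.

Lemma mlen_join_index alpha k p : mlen (join_index alpha k p) = (mlen alpha + p)%N.
Proof.
rewrite /mlen big_split_ord /=; congr addn.
  by apply: eq_bigr => i _; rewrite join_indexl.
rewrite (bigD1 k)//= join_indexr eqxx big1 ?addn0// => i /negbTE ik.
by rewrite join_indexr ik.
Qed.

Lemma enum_ordD : enum 'I_(r + s) =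
  map (@lshift r s) (enum 'I_r) ++ map (@rshift r s) (enum 'I_s).
Proof.
apply: (inj_map val_inj); rewrite [LHS]val_enum_ord map_cat iotaD add0n.
congr cat; first by rewrite -val_enum_ord; elim: (enum 'I_r) => //= i l ->.
rewrite -[in LHS](addn0 r) iotaDl -val_enum_ord.
by elim: (enum 'I_s) => //= i l ->.
Qed.

(** Derivatives in x are applied before those in t, since the enumeration of the
coordinates lists the t-coordinates first.  So the x-derivatives can be
integrated by parts and the t-derivatives taken out of the integral, and no
commutation of partial derivatives occurs. *)
Lemma fourier_coef_Dalpha eta alpha (k : 'I_s) p lam : smooth_torus lam ->
  fourier_coef eta (Dalpha (join_index alpha k p) lam) =
  ((- (eta 0 k)%:~R)%:C)%C ^+ p *: Dalpha alpha (fourier_coef eta lam).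
Proof.
move=> sl; rewrite /Dalpha enum_ordD foldr_cat.
rewrite -[foldr _ lam _]/(iter_Dop (join_index alpha k p)
  (map (@rshift r s) (enum 'I_s)) lam).
rewrite (iter_Dop_single (k := rshift r k)); first last.
- move=> _ /mapP[j _ ->].
  by rewrite (inj_eq (@rshift_inj _ _)) join_indexr => /negbTE ->.
- by rewrite map_inj_uniq ?enum_uniq//; exact: rshift_inj.
- by rewrite map_f// mem_enum.
have alE : (fun i => join_index alpha k p (lshift s i)) = alpha.
  by apply/funext => i; rewrite join_indexl.
rewrite join_indexr eqxx -[foldr _ _ _]/(iter_Dop (join_index alpha k p) _ _).
rewrite -iter_Dop_fourier_coef ?alE; last exact: smooth_torus_iter.
rewrite fourier_coef_iter_Dop// iter_DopZ//.
exact: smooth_torus_fourier_coef.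
Qed.

End FourierCoefficientDerivatives.

(** * Weights and the derivative bounds they define *)
Section WeightSequences.
Context {R : realType} (m : nat -> R) (hm : weight_sequence m).

(** Log-convexity makes the ratios of successive weights increase, starting from
1. *)
Lemma weight_ge1 n : 1 <= m n.
Proof.
suff : 1 <= m n /\ m n <= m n.+1 by case.
elim: n => [|n [n1 nS]]; first by rewrite (weight0 hm) (weight1 hm).
split; first exact: le_trans nS.
rewrite -(ler_pM2l (weight_gt0 hm n.+1)) -expr2.
rewrite (le_trans (weight_logconvex hm n))// ler_pM2r//; exact: weight_gt0.
Qed.

(** The binomial coefficient is one of the terms of (1 + 1)^(j + k). *)
Lemma fact_add_le j k : (j + k)`!%:R <= 2 ^+ (j + k) * (j`!%:R * k`!%:R) :> R.
Proof.
rewrite -natrX -!natrM ler_nat -(bin_fact (leq_addr k j)) addKn leq_mul2r.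
apply/orP; right; rewrite -[X in (X ^ _)%N]/(1 + 1)%N expnDn.
rewrite (bigD1 (inord j)) //= inordK ?ltnS ?leq_addr//.
by rewrite !exp1n !muln1 leq_addr.
Qed.

(** Moderate growth of m n * n!: the factor 2 added to the constant of m pays for
the binomial coefficient. *)
Lemma weight_fact_add_le : exists2 H : R, 1 <= H & forall j k,
  m (j + k)%N * (j + k)`!%:R <= H ^+ (j + k) * ((m j * j`!%:R) * (m k * k`!%:R)).
Proof.
have [H H1 mH] := weight_moderate hm.
exists (2 * H).
  by rewrite (le_trans (ltW H1))// ler_peMl ?ler1n// ltW// (lt_trans _ H1).
move=> j k.
apply: (@le_trans _ _ ((H ^+ (j + k) * m j * m k) * (2 ^+ (j + k) * (j`!%:R * k`!%:R)))).
  by apply: ler_pM => //; [exact: ltW (weight_gt0 hm _)|exact: fact_add_le].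
by rewrite exprMn le_eqVlt; apply/orP; left; apply/eqP; ring.
Qed.

End WeightSequences.

Section Norms.
Context {R : realType} (m : nat -> R) (hm : weight_sequence m) {d : nat}.
Implicit Types (f : complex_fun R d) (h B : R).

(** The statement that the norm of index h is at most B, without extended
reals; see [Mnorm_leP]. *)
Definition deriv_bound h B f : Prop := forall x (alpha : {ffun 'I_d -> nat}),
  cmod (Dalpha alpha f x) <= B * (h ^+ mlen alpha * m (mlen alpha) * (mlen alpha)`!%:R).

Lemma weight_denom_gt0 h n : 0 < h -> 0 < h ^+ n * m n * n`!%:R.
Proof.
by move=> h0; rewrite !mulr_gt0 ?exprn_gt0 ?ltr0n ?fact_gt0//; exact: weight_gt0.
Qed.

Lemma Mnorm_leP h B f : 0 < h -> (Mnorm m h f <= B%:E)%E <-> deriv_bound h B f.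
Proof.
move=> h0; split=> [H x alpha|H].
  rewrite -ler_pdivrMr ?weight_denom_gt0// -lee_fin (le_trans _ H)//.
  by apply: ereal_sup_ubound; exists x, alpha.
apply: ge_ereal_sup => _ [x [alpha ->]].
by rewrite lee_fin ler_pdivrMr ?weight_denom_gt0.
Qed.

Lemma Mnorm_ge0 h f : 0 < h -> (0 <= Mnorm m h f)%E.
Proof.
move=> h0; set alpha := [ffun _ => 0%N] : {ffun 'I_d -> nat}.
apply: (@le_trans _ _ (cmod (Dalpha alpha f 0) /
         (h ^+ mlen alpha * m (mlen alpha) * (mlen alpha)`!%:R))%:E).
  by rewrite lee_fin divr_ge0 ?cmod_ge0// ltW// weight_denom_gt0.
by apply: ereal_sup_ubound; exists 0, alpha.
Qed.

Lemma deriv_bound_ge0 h B f : 0 < h -> deriv_bound h B f -> 0 <= B.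
Proof.
move=> h0 /(Mnorm_leP _ _ h0) H; rewrite -lee_fin (le_trans _ H)//; exact: Mnorm_ge0.
Qed.

Lemma deriv_bound_le h h' B f : 0 < h -> h <= h' -> deriv_bound h B f -> deriv_bound h' B f.
Proof.
move=> h0 hh' H; have B0 := deriv_bound_ge0 h0 H; move=> x alpha.
rewrite (le_trans (H x alpha))// ler_wpM2l// -!mulrA ler_wpM2r//.
  by rewrite mulr_ge0// ltW// (weight_gt0 hm).
by rewrite lerXn2r ?nnegrE// ltW// (lt_le_trans h0).
Qed.

(** The index can be taken at least 1 since the norms decrease in h; this
makes (h H)^p m_p p! at least 1 in the decay estimate. *)
Lemma EM_deriv_bound f : Defs.EM m f ->
  smooth_torus f /\ exists h B, 1 <= h /\ deriv_bound h B f.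
Proof.
move=> [sf [C [h [C0 h0 H]]]]; split=> //; exists (Num.max h 1), C; split.
  by rewrite le_max lexx orbT.
apply: (@deriv_bound_le h); rewrite ?le_max ?lexx//.
by move=> x alpha; rewrite !mulrA.
Qed.

Lemma deriv_bound_EM h B f : 0 < h -> smooth_torus f -> deriv_bound h B f -> Defs.EM m f.
Proof.
move=> h0 sf H; split=> //; exists (B + 1), h; split=> //.
  by rewrite ltr_wpDl//; exact: deriv_bound_ge0 H.
move=> x alpha; rewrite (le_trans (H x alpha))// -!mulrA ler_wpM2r ?lerDl//.
by rewrite mulrA ltW// weight_denom_gt0.
Qed.

Lemma deriv_bound_lin h B B' (a : R[i]) f g : smooth_torus f -> smooth_torus g ->
  deriv_bound h B f -> deriv_bound h B' g ->
  deriv_bound h (cmod a * B + B') (a *: f + g).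
Proof.
move=> sf sg bf bg x alpha; rewrite Dalpha_lin//.
rewrite (le_trans (cmodD _ _))// mulrDl lerD// cmodM -mulrA ler_wpM2l ?cmod_ge0//.
Qed.

Lemma EM_lin (a : R[i]) f g : Defs.EM m f -> Defs.EM m g -> Defs.EM m (a *: f + g).
Proof.
move=> /EM_deriv_bound[sf [h [B [h1 bf]]]] /EM_deriv_bound[sg [h' [B' [h1' bg]]]].
have h0 : 0 < h := lt_le_trans ltr01 h1; have h0' : 0 < h' := lt_le_trans ltr01 h1'.
have bf' : deriv_bound (Num.max h h') B f.
  by apply: (deriv_bound_le h0) bf; rewrite le_max lexx.
have bg' : deriv_bound (Num.max h h') B' g.
  by apply: (deriv_bound_le h0') bg; rewrite le_max lexx orbT.
apply: (deriv_bound_EM _ _ (deriv_bound_lin a sf sg bf' bg')).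
  by rewrite lt_max h0.
exact: smooth_torus_lin.
Qed.

End Norms.

(** * Decay of the coefficients and of the pairings *)
Section FrequencyNorm.
Context {R : realType} {s : nat}.
Implicit Types (eta : 'rV[int]_s).
Local Notation normZ := (@normZ R s).

Lemma normZ_ge0 eta : 0 <= normZ eta.
Proof. exact: sqrtr_ge0. Qed.

Lemma normr_entry_le_normZ eta k : `|(eta 0 k)%:~R| <= normZ eta.
Proof.
rewrite -sqrtr_sqr ler_wsqrtr// (bigD1 k)//= lerDl sumr_ge0// => i _.
exact: sqr_ge0.
Qed.

(** Integration by parts only gains a power of one coordinate of the frequency;
the largest coordinate controls the norm.  The maximum with 1 covers the zero
frequency. *)
Lemma normZ_le_max_entry eta : (0 < s)%N ->
  exists k, 1 + normZ eta <= s.+1%:R * Num.max 1 `|(eta 0 k)%:~R|.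
Proof.
move=> s0; pose i0 := Ordinal s0.
have [k kmax] : exists k, forall i, `|(eta 0 i)%:~R| <= `|(eta 0 k)%:~R| :> R.
  case: (@Order.TotalTheory.arg_maxP _ _ _ i0 predT
    (fun i => `|(eta 0 i)%:~R| : R)) => // k _ H.
  by exists k => i; exact: H.
exists k; set c := `|_|; have c0 : 0 <= c by exact: normr_ge0.
have nk : normZ eta <= s%:R * c.
  rewrite -[leRHS]ger0_norm; last by rewrite mulr_ge0.
  rewrite -sqrtr_sqr ler_wsqrtr//.
  apply: (@le_trans _ _ (\sum_(i < s) c ^+ 2)).
    apply: ler_sum => i _; by rewrite -real_normK ?num_real// lerXn2r ?nnegrE//.
  rewrite sumr_const card_ord -[leLHS]mulr_natl exprMn ler_wpM2r ?sqr_ge0//.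
  by rewrite expr2 ler_peMl// ler1n.
rewrite -natr1 mulrDl mul1r addrC lerD ?le_max ?lexx//.
by rewrite (le_trans nk)// ler_wpM2l// le_max lexx orbT.
Qed.

End FrequencyNorm.

Section FourierDecay.
Context {R : realType} (m : nat -> R) (hm : weight_sequence m) {r s : nat}.
Implicit Types (lam : complex_fun R (r + s)) (eta : 'rV[int]_s) (h H B : R).

(** Integrate by parts p times in the coordinate where eta is largest: this gains
(1 + |eta|)^p and costs the derivative bound of order |alpha| + p, which
moderate growth splits into a factor for alpha and a factor for p. *)
Lemma fourier_coef_decay h H B eta lam p : (0 < s)%N -> 1 <= h -> 1 <= H ->
  (forall j k, m (j + k)%N * (j + k)`!%:R <=
     H ^+ (j + k) * ((m j * j`!%:R) * (m k * k`!%:R))) ->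
  smooth_torus lam -> deriv_bound m h B lam ->
  deriv_bound m (h * H)
    (4 * (2 * pi) ^+ s * B * ((s.+1%:R * (h * H)) ^+ p * (m p * p`!%:R))
       / (1 + normZ eta) ^+ p)
    (fourier_coef eta lam).
Proof.
move=> s0 h1 H1 mH sl bl t alpha.
have h0 : 0 < h := lt_le_trans ltr01 h1; have H0 : 0 < H := lt_le_trans ltr01 H1.
have B0 := deriv_bound_ge0 hm h0 bl.
set X := cmod _; set D := (_ * _ * (mlen alpha)`!%:R).
have X0 : 0 <= X := cmod_ge0 _.
have D0 : 0 < D by apply: (weight_denom_gt0 hm); rewrite mulr_gt0.
set K : R := 4 * (2 * pi) ^+ s.
have K0 : 0 <= K by rewrite mulr_ge0// exprn_ge0// mulr_ge0// pi_ge0.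
pose M n := (h * H) ^+ n * (m n * n`!%:R).
have M1 n : 1 <= M n.
  rewrite /M mulr_ege1 ?exprn_ege1 ?mulr_ege1//; first exact: (weight_ge1 hm).
  by rewrite ler1n fact_gt0.
have step k n : `|(eta 0 k)%:~R| ^+ n * X <= K * B * M n * D.
  have := @cmod_fourier_coef_le R r s eta (Dalpha (join_index alpha k n) lam)
     (B * M n * D) t.
  rewrite fourier_coef_Dalpha// -[(_ *: _) t]/(_ * Dalpha alpha (fourier_coef eta lam) t).
  rewrite cmodM cmodX cmod_real normrN -/X !mulrA -/K; apply.
    by apply: smooth_torus_continuous; exact: smooth_torus_Dalpha.
  move=> y; rewrite (le_trans (bl _ _))// -!mulrA ler_wpM2l//.
  rewrite mlen_join_index [leRHS](_ : _ = h ^+ (mlen alpha + n) *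
    (H ^+ (mlen alpha + n) * ((m (mlen alpha) * (mlen alpha)`!%:R) * (m n * n`!%:R)))).
    by rewrite ler_wpM2l ?exprn_ge0 ?(ltW h0)//; exact: mH.
  by rewrite /M /D !exprMn !exprD; ring.
have [k kmax] := normZ_le_max_entry (R := R) eta s0.
have n0 : 0 < 1 + normZ eta :> R by rewrite ltr_pwDl// normZ_ge0.
rewrite mulrAC ler_pdivlMr ?exprn_gt0// mulrC.
apply: (@le_trans _ _ ((s.+1%:R * Num.max 1 `|(eta 0 k)%:~R|) ^+ p * X)).
  by rewrite ler_wpM2r// lerXn2r ?nnegrE ?(ltW n0)// (le_trans (ltW n0)).
rewrite [in leRHS]exprMn exprMn -[leLHS]mulrA.
rewrite [leRHS](_ : _ = s.+1%:R ^+ p * (K * B * M p * D)); last by rewrite /M; ring.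
rewrite ler_wpM2l ?exprn_ge0//.
case: (leP 1 `|(eta 0 k)%:~R|) => _; first exact: step.
(* Here the maximum is 1: the bound of order 0 suffices, since M p >= 1. *)
rewrite expr1n mul1r; have := step k 0%N.
rewrite expr0 mul1r => /le_trans; apply.
rewrite ler_wpM2r ?(ltW D0)// (ler_wpM2l (mulr_ge0 K0 B0))//.
by rewrite {1}/M expr0 (weight0 hm) fact0 !mulr1 M1.
Qed.

End FourierDecay.

Section PairingDecay.
Context {R : realType} (m : nat -> R) (hm : weight_sequence m) {r s : nat}.

(** The decay of the coefficients at order p + q beats the growth allowed at
order p, uniformly in p, once eps is small; the q further powers survive. *)
Lemma pairing_decay (u_ : 'rV[int]_s -> complex_fun R r -> R[i]^o) :
  (0 < s)%N ->
  (forall eps h : R, 0 < eps -> 0 < h ->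
       exists2 C : R, 0 < C &
         forall (eta : 'rV[int]_s) (psi : complex_fun R r), EMh m h psi ->
           ((cmod (u_ eta psi))%:E <=
              C%:E * Mnorm m h psi *
              ereal_sup [set z | exists p : nat,
                z = (eps ^+ p * (1 + normZ eta) ^+ p
                     / (m p * p`!%:R))%:E])%E) ->
  forall (h : R) (q : nat), 1 <= h -> exists2 K : R, 0 <= K &
    forall (eta : 'rV[int]_s) (lam : complex_fun R (r + s)) (B : R),
      smooth_torus lam -> deriv_bound m h B lam ->
      cmod (tensor_exp (u_ eta) eta lam) <= K * B / (1 + normZ eta) ^+ q.
Proof.
move=> s0 u_bound h q h1.
have h0 : 0 < h := lt_le_trans ltr01 h1.
have [H H1 mH] := weight_fact_add_le hm; have H0 : 0 < H := lt_le_trans ltr01 H1.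
have mf0 n : 0 < m n * n`!%:R by rewrite mulr_gt0 ?(weight_gt0 hm)// ltr0n fact_gt0.
set A := s.+1%:R * (h * H).
have A0 : 0 < A by rewrite !mulr_gt0.
have hH0 : 0 < h * H by rewrite mulr_gt0.
(* With eps = 1 / (A H), eps^p cancels the factor (A H)^p of the decay estimate
   of order p + q. *)
have eps0 : 0 < (A * H)^-1 by rewrite invr_gt0 mulr_gt0.
have [C C0 HC] := u_bound _ _ eps0 hH0.
set K0 : R := 4 * (2 * pi) ^+ s.
have K00 : 0 <= K0 by rewrite mulr_ge0// exprn_ge0// mulr_ge0// pi_ge0.
pose K1 := K0 * ((A * H) ^+ q * (m q * q`!%:R)).
have K10 : 0 <= K1 by rewrite mulr_ge0// mulr_ge0 ?ltW ?exprn_gt0// mulr_gt0.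
exists (C * K1); first by rewrite mulr_ge0// ltW.
move=> eta lam B sl bl.
have B0 := deriv_bound_ge0 hm h0 bl.
have n0 : 0 < 1 + normZ eta :> R by rewrite ltr_pwDl// normZ_ge0.
have decay p := fourier_coef_decay hm eta p s0 h1 H1 mH sl bl.
have Mn p := proj2 (Mnorm_leP hm _ _ hH0) (decay p).
set f := fourier_coef eta lam in decay Mn *.
have Mge0 := Mnorm_ge0 hm f hH0.
have Mfin : Mnorm m (h * H) f \is a fin_num.
  by rewrite ge0_fin_numE// (le_lt_trans (Mn 0%N))// ltry.
have fE : EMh m (h * H) f.
  by split; [exact: smooth_torus_fourier_coef|rewrite -ge0_fin_numE].
have := HC eta f fE.
rewrite -[u_ eta f]/(tensor_exp (u_ eta) eta lam) -lee_fin => /le_trans; apply.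
set N := fine (Mnorm m (h * H) f).
have NE : Mnorm m (h * H) f = N%:E by rewrite fineK.
have N0 : 0 <= N by rewrite -lee_fin -NE.
set X := K1 * B / (1 + normZ eta) ^+ q.
have X0 : 0 <= X := divr_ge0 (mulr_ge0 K10 B0) (exprn_ge0 _ (ltW n0)).
rewrite NE -[C * K1 * B / _](_ : C * X = _); last by rewrite /X !mulrA.
rewrite -muleA EFinM; apply: lee_wpmul2l; first by rewrite lee_fin ltW.
(* If the norm vanishes the product is 0 even when the supremum is infinite;
   otherwise divide by the norm to bound the supremum. *)
have [N00|Nn0] := eqVneq N 0; first by rewrite N00 mul0e lee_fin.
have Np : 0 < N by rewrite lt_neqAle eq_sym Nn0.
apply: (@le_trans _ _ (N%:E * (X / N)%:E)%E); last first.
  by rewrite -EFinM lee_fin mulrC divfK.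
apply: lee_wpmul2l; first by rewrite lee_fin.
apply: ge_ereal_sup => _ [p ->]; rewrite lee_fin ler_pdivlMr// mulrC.
have Np_le := Mn (p + q)%N; rewrite NE lee_fin -/A -/K0 in Np_le.
rewrite [leLHS]mulrC; apply: (le_trans (ler_wpM2l _ Np_le)).
  by rewrite divr_ge0 ?(ltW (mf0 p))// mulr_ge0 ?exprn_ge0 ?(ltW eps0) ?(ltW n0).
set n := 1 + normZ eta in n0 *.
have np0 k : 0 < n ^+ k by rewrite exprn_gt0.
apply: (@le_trans _ _ ((A * H)^-1 ^+ p * n ^+ p / (m p * p`!%:R) *
    (K0 * B * (A ^+ (p + q) *
      (H ^+ (p + q) * ((m p * p`!%:R) * (m q * q`!%:R)))) / n ^+ (p + q)))).
  rewrite ler_wpM2l//.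
    by rewrite divr_ge0 ?(ltW (mf0 p))// mulr_ge0 ?exprn_ge0 ?(ltW eps0) ?(ltW n0).
  rewrite ler_wpM2r ?invr_ge0 ?(ltW (np0 _))// (ler_wpM2l (mulr_ge0 K00 B0))//.
  by rewrite (ler_wpM2l (exprn_ge0 _ (ltW A0)))//; exact: mH.
rewrite le_eqVlt; apply/orP; left; apply/eqP.
rewrite /X /K1 !exprVn !exprMn !exprD; field.
by rewrite !(gt_eqF (np0 _)) !expf_neq0 ?(gt_eqF H0) ?(gt_eqF h0) 
  ?(gt_eqF (weight_gt0 hm _)) ?pnatr_eq0 -?lt0n ?fact_gt0.
Qed.

End PairingDecay.

(** * Summation over the frequencies *)
Section RealSequences.
Context {R : realType}.

(** With w_j = c / (j + 1), the sequence v + w is nonincreasing and bounded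
below, and w tends to 0. *)
Lemma cvg_dominated_increments (v : R^nat) (c : R) : 0 <= c ->
  (forall j, `|v j.+1 - v j| <= c / j.+1%:R - c / j.+2%:R) ->
  cvgn v /\ `|limn v| <= `|v 0%N| + c.
Proof.
move=> c0 H; pose w j : R := c / j.+1%:R.
have w0 j : 0 <= w j by rewrite /w divr_ge0.
have vle j : `|v j - v 0%N| <= c - w j.
  elim: j => [|j IH]; first by rewrite subrr normr0 /w divr1 subrr.
  rewrite -(subrK (v j) (v j.+1)) -addrA (le_trans (ler_normD _ _))//.
  rewrite (le_trans (lerD (H j) IH))// /w le_eqVlt; apply/orP; left; apply/eqP; ring.
have wcvg : w j @[j --> \oo] --> 0.
  rewrite -[0](mulr0 c); apply: cvgMl_tmp; exact: cvg_harmonic.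
pose z j := v j + w j.
have zdec : nonincreasing_seq z.
  apply/nonincreasing_seqP => j; rewrite /z -lerBrDr -addrA.
  have := le_trans (ler_norm _) (H j); rewrite -/(w j) -/(w j.+1); lra.
have zlb : has_lbound (range z).
  exists (v 0%N - c) => _ [j _ <-]; rewrite /z.
  have := vle j; rewrite ler_norml => /andP[+ _]; have := w0 j; lra.
have zcvg := nonincreasing_is_cvgn zdec zlb.
have vE : v = z - w by apply/funext => j; rewrite /z /= !fctE addrK.
have vcvg : cvgn v.
  rewrite vE; apply: is_cvgB => //; apply/cvg_ex; exists 0; exact: wcvg.
split=> //; rewrite -lim_norm//.
apply: limr_le; first exact: is_cvg_norm.
apply: nearW => j; rewrite -(subrK (v 0%N) (v j)) (le_trans (ler_normD _ _))//.
by rewrite addrC lerD2l (le_trans (vle j))// lerBlDr lerDl.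
Qed.

Lemma inv_sqr_le_telescope (j : nat) :
  (j.+1%:R : R) ^- 2 <= 2 / j.+1%:R - 2 / j.+2%:R.
Proof.
rewrite -[j.+2%:R]natr1; set x : R := j.+1%:R.
have x1 : 1 <= x by rewrite ler1n.
have -> : 2 / x - 2 / (x + 1) = (2 * x / (x + 1)) * x ^- 2.
  by field; rewrite ?gt_eqF//; lra.
rewrite ler_peMl ?invr_ge0 ?sqr_ge0// ler_pdivlMr; lra.
Qed.

End RealSequences.

Section FrequencySums.
Context {R : realType} {s : nat}.
Implicit Types (eta : 'rV[int]_s) (a : 'rV[int]_s -> R[i]^o).

Definition freq_ball (j : nat) : set 'rV[int]_s :=
  [set eta | @normZ R s eta <= j%:R].

(** A parametrization of the integer points of the cube [-j, j]^s, for counting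
them. *)
Definition freq_of_box (j : nat) (phi : {ffun 'I_s -> 'I_(j + j).+1}) : 'rV[int]_s :=
  \row_k ((phi k)%:Z - j%:Z).

Lemma freq_ball_box j eta : freq_ball j eta ->
  exists phi, eta = @freq_of_box j phi.
Proof.
move=> H; exists [ffun k => inord (absz (eta 0 k + j%:Z))].
apply/rowP => k; rewrite mxE ffunE.
have : `|eta 0 k|%:~R <= (j%:Z)%:~R :> R.
  by rewrite intr_norm (le_trans (normr_entry_le_normZ eta k)).
rewrite ler_int ler_norml => /andP[h1 h2].
have h3 : 0 <= eta 0 k + j%:Z by rewrite -lerBlDr sub0r.
rewrite inordK; first by rewrite gez0_abs// addrK.
rewrite ltnS -lez_nat gez0_abs// PoszD lerD2r//.
Qed.

Lemma finite_freq_ball j : finite_set (freq_ball j).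
Proof.
apply: (@sub_finite_set _ _ (@freq_of_box j @` setT)); last first.
  exact/finite_image/finite_finset.
by move=> eta /freq_ball_box[phi ->]; exists phi.
Qed.

Lemma card_freq_ball j : (#|` fset_set (freq_ball j)| <= (j + j).+1 ^ s)%N.
Proof.
have -> : ((j + j).+1 ^ s)%N =
    size (map (@freq_of_box j) (enum {: {ffun 'I_s -> 'I_(j + j).+1}})).
  by rewrite size_map -cardE card_ffun !card_ord.
apply: uniq_leq_size; first exact: fset_uniq.
move=> eta; rewrite in_fset_set; last exact: finite_freq_ball.
by move=> /set_mem/freq_ball_box[phi ->]; rewrite map_f// mem_enum.
Qed.

Lemma cmod_fsum_le a (D : set 'rV[int]_s) j (M : R) : 0 <= M -> D `<=` freq_ball j ->
  (forall eta, D eta -> cmod (a eta) <= M) ->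
  cmod (\sum_(eta \in D) a eta) <= (j + j).+1%:R ^+ s * M.
Proof.
move=> M0 DA aM; have fD := sub_finite_set DA (finite_freq_ball j).
rewrite fsbig_finite//=.
apply: (@le_trans _ _ (\sum_(eta <- fset_set D) M)).
  rewrite [leRHS]big_seq [X in cmod X]big_seq.
  elim/big_ind2: _ => [|x c y d xc yd|eta].
  - by rewrite cmod0.
  - by rewrite (le_trans (cmodD _ _))// lerD.
  - by rewrite in_fset_set// => /set_mem; exact: aM.
rewrite big_const_seq count_predT iter_addr_0 -[leLHS]mulr_natl ler_wpM2r// -natrX ler_nat.
rewrite (leq_trans _ (card_freq_ball j))// fsubset_leq_card//.
by rewrite -fset_set_sub//; exact: finite_freq_ball.
Qed.

(** The terms new in the ball of radius j + 1 number at most (2 j + 3)^s and each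
is at most M / (j + 1)^(s + 2), so the increments are of order 1 / (j + 1)^2
and are dominated by a telescoping sequence. *)
Lemma cvg_freq_sum a (M : R) : 0 <= M ->
  (forall eta, cmod (a eta) <= M / (1 + normZ eta) ^+ s.+2) ->
  exists2 l : R[i]^o,
    (\sum_(eta \in freq_ball j) a eta) @[j --> \oo] --> l &
    cmod l <= 2 * (1 + 2 * 3 ^+ s) * M.
Proof.
move=> M0 aM; pose S j := \sum_(eta \in freq_ball j) a eta.
set c : R := 2 * 3 ^+ s * M.
have c0 : 0 <= c by rewrite !mulr_ge0// exprn_ge0.
have sub j : freq_ball j `<=` freq_ball j.+1.
  by move=> eta /= h; rewrite /freq_ball/= (le_trans h)// ler_nat.
have SD j : S j.+1 - S j = \sum_(eta \in freq_ball j.+1 `\` freq_ball j) a eta.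
  rewrite /S (fsbigID (freq_ball j) (freq_ball j.+1)) /=; last exact: finite_freq_ball.
  by rewrite (setIidr (@sub j)) addrAC subrr add0r.
have Sle j : cmod (S j.+1 - S j) <= c / j.+1%:R - c / j.+2%:R.
  rewrite SD; apply: (@le_trans _ _ ((j.+1 + j.+1).+1%:R ^+ s * (M / j.+1%:R ^+ s.+2))).
    apply: cmod_fsum_le; first by rewrite divr_ge0// exprn_ge0.
      by move=> eta [].
    move=> eta [_ /negP]; rewrite -ltNge => jn.
    rewrite (le_trans (aM eta))// ler_wpM2l// lef_pV2 ?posrE ?exprn_gt0//; last first.
      by rewrite ltr_pwDl// normZ_ge0.
    by rewrite lerXn2r ?nnegrE// ?addr_ge0 ?normZ_ge0// -nat1r lerD2l ltW.
  have -> : c / j.+1%:R - c / j.+2%:R = 3 ^+ s * M * (2 / j.+1%:R - 2 / j.+2%:R).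
    by rewrite /c; ring.
  apply: (@le_trans _ _ (3 ^+ s * M * j.+1%:R ^- 2)); last first.
    by rewrite ler_wpM2l ?mulr_ge0 ?exprn_ge0// inv_sqr_le_telescope.
  apply: (@le_trans _ _ ((3 * j.+1%:R) ^+ s * (M / j.+1%:R ^+ s.+2))).
    rewrite ler_wpM2r ?divr_ge0 ?exprn_ge0// lerXn2r ?nnegrE//.
    by rewrite -natrM ler_nat !mulSn mul0n addn0 addnA -addn1 leq_add2l.
  rewrite le_eqVlt; apply/orP; left; apply/eqP.
  have : j.+1%:R != 0 :> R by rewrite pnatr_eq0.
  move: (j.+1%:R : R) => x x0.
  by rewrite -[s.+2]addn2 exprD exprMn; field; rewrite ?expf_neq0 ?x0.
have S0 : cmod (S 0%N) <= M.
  have := @cmod_fsum_le a (freq_ball 0) 0 M M0 (@subset_refl _ _).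
  rewrite expr1n mul1r; apply=> eta _; rewrite (le_trans (aM eta))//.
  by rewrite ler_pdivrMr ?exprn_gt0 ?ler_peMr ?exprn_ege1 ?ltr_pwDl ?lerDl ?normZ_ge0.
have [|rcvg rle] := @cvg_dominated_increments R (fun j => complex.Re (S j)) c c0.
  by move=> j; rewrite -ReB (le_trans (normr_Re_le _)).
have [|icvg ile] := @cvg_dominated_increments R (fun j => complex.Im (S j)) c c0.
  by move=> j; rewrite -ImB (le_trans (normr_Im_le _)).
exists (limn (fun j => complex.Re (S j)) +i* limn (fun j => complex.Im (S j)))%C.
  by apply/cvg_complexP.
rewrite (le_trans (cmod_le_ReIm _))//= (le_trans (lerD rle ile))//.
have := le_trans (normr_Re_le _) S0; have := le_trans (normr_Im_le _) S0.
by rewrite /c; lra.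
Qed.

End FrequencySums.

(** * Continuity on the inductive limit and the theorem *)
Section LinearOnEM.
Context {R : realType} (m : nat -> R) (hm : weight_sequence m) {d : nat}.

Lemma EM_scale (c : R[i]) (f : complex_fun R d) : Defs.EM m f -> Defs.EM m (c *: f).
Proof.
move=> Ef; rewrite -(subrK 1 c) scalerDl scale1r; exact: EM_lin.
Qed.

Lemma EM_linear_combination (u : complex_fun R d -> R[i]^o) :
  (forall (a : R[i]) f g, Defs.EM m f -> Defs.EM m g -> u (a *: f + g) = a * u f + u g) ->
  forall (a b : R[i]) f g, Defs.EM m f -> Defs.EM m g ->
    u (a *: f + b *: g) = a * u f + b * u g.
Proof.
move=> ulin a b f g Ef Eg; rewrite ulin//; last exact: EM_scale.
congr (_ + _); rewrite -[in LHS](subrK 1 b) scalerDl scale1r ulin//.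
by rewrite -[X in _ + X]mul1r -mulrDl subrK.
Qed.

End LinearOnEM.

Section ContinuityCriterion.
Context {R : realType} (m : nat -> R) (hm : weight_sequence m) (hn : nat -> R).
Context (hhn : inductive_parameters hn) {d : nat}.

(** A neighbourhood of 0 in the inductive limit is any absolutely convex set that
contains a ball of each Banach step.  The set where |u| < e is absolutely
convex by linearity, and the bounds on the steps provide the balls. *)
Lemma ultradistribution_of_bounds (u : complex_fun R d -> R[i]^o) :
  (forall (a : R[i]) f g, Defs.EM m f -> Defs.EM m g -> u (a *: f + g) = a * u f + u g) ->
  (forall h, 1 <= h -> exists2 K : R, 0 <= K & forall f B,
     smooth_torus f -> deriv_bound m h B f -> cmod (u f) <= K * B) ->
  ultradistribution m hn u.
Proof.
move=> ulin ubnd; split=> // W oW; split=> [f []//|f [Ef Wf]].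
have [e e0 We] : exists2 e : R, 0 < e & forall z, cmod (u f - z) < e -> W z.
  have /nbhs_ballP[e /= e0 He] : nbhs (u f) W by exact: open_nbhs_nbhs.
  move: e0; rewrite ltcE /= => /andP[/eqP ei er]; exists (complex.Re e) => // z hz.
  apply: He; rewrite -ball_normE /ball_ /=.
  have -> : e = (complex.Re e)%:C%C by case: e ei {er hz} => a b /= ->.
  by rewrite -cmodE ltcR.
exists [set g | Defs.EM m g /\ cmod (u g) < e]; last first.
  move=> g [Eg ug]; split.
    by rewrite -[f]scale1r; exact: EM_lin.
  by apply: We; rewrite -[f in u (f + _)]scale1r ulin// mul1r opprD addNKr cmodN.
split=> [g []//|f1 g1 a b [Ef1 uf1] [Eg1 ug1] ab|n].
  split.
    by apply: EM_lin => //; exact: EM_scale.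
  rewrite (EM_linear_combination hm ulin)//.
  rewrite (le_lt_trans (cmodD _ _))// !cmodM.
  set M := Num.max (cmod (u f1)) (cmod (u g1)).
  have Me : M < e by rewrite /M gt_max uf1.
  have M0 : 0 <= M by rewrite le_max cmod_ge0.
  apply: le_lt_trans Me; rewrite -[leRHS]mul1r.
  apply: (@le_trans _ _ ((cmod a + cmod b) * M)).
    by rewrite mulrDl lerD// ler_wpM2l ?cmod_ge0// le_max lexx ?orbT.
  by rewrite ler_wpM2r// -lecR rmorphD /= !cmodE.
have h0 : 0 < hn n by case: hhn.
have [|K K0 HK] := ubnd (Num.max (hn n) 1); first by rewrite le_max lexx orbT.
(* K may be 0, whence K + 1. *)
exists (e / (K + 1)); first by rewrite divr_gt0// ltr_wpDl.
move=> g [sg _] /ltW/(Mnorm_leP hm _ _ h0) bg.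
split; first exact: (deriv_bound_EM hm h0 sg bg).
have bg' : deriv_bound m (Num.max (hn n) 1) (e / (K + 1)) g.
  by apply: (deriv_bound_le hm h0) bg; rewrite le_max lexx.
rewrite (le_lt_trans (HK _ _ sg bg'))// mulrA ltr_pdivrMr ?ltr_wpDl// mulrC.
by rewrite ltr_pM2l// ltrDl.
Qed.

End ContinuityCriterion.

Theorem theorem5p7 (R : realType) (m : nat -> R) (hm : weight_sequence m)
    (hn : nat -> R) (hhn : inductive_parameters hn)
    (r s : nat) (r_gt0 : (0 < r)%N) (s_gt0 : (0 < s)%N)
    (u_ : 'rV[int]_s -> complex_fun R r -> R[i]^o)
    (u_dual : forall eta, ultradistribution m hn (u_ eta))
    (u_bound : forall eps h : R, 0 < eps -> 0 < h ->
       exists2 C : R, 0 < C &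
         forall (eta : 'rV[int]_s) (psi : complex_fun R r), EMh m h psi ->
           ((cmod (u_ eta psi))%:E <=
              C%:E * Mnorm m h psi *
              ereal_sup [set z | exists p : nat,
                z = (eps ^+ p * (1 + normZ eta) ^+ p
                     / (m p * p`!%:R))%:E])%E) :
  exists u : complex_fun R (r + s) -> R[i]^o,
    ultradistribution m hn u /\
    ultradistribution_cvg m (fourier_partial_sum u_) u.
Proof.
have bnd h : 1 <= h -> exists2 K : R, 0 <= K & forall lam B,
    smooth_torus lam -> deriv_bound m h B lam -> exists2 l : R[i]^o,
      fourier_partial_sum u_ j lam @[j --> \oo] --> l & cmod l <= K * B.
  move=> h1; have [K K0 HK] := pairing_decay hm s_gt0 u_bound s.+2 h1.
  exists (2 * (1 + 2 * 3 ^+ s) * K).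
    by rewrite !mulr_ge0// addr_ge0// mulr_ge0// exprn_ge0.
  move=> lam B sl bl.
  have KB0 : 0 <= K * B.
    by rewrite mulr_ge0// (deriv_bound_ge0 hm (lt_le_trans ltr01 h1) bl).
  have [l Sl ll] := cvg_freq_sum KB0 (fun eta => HK eta lam B sl bl).
  by exists l => //; rewrite -mulrA.
have tlin eta (a : R[i]) f g : Defs.EM m f -> Defs.EM m g ->
    tensor_exp (u_ eta) eta (a *: f + g) =
    a * tensor_exp (u_ eta) eta f + tensor_exp (u_ eta) eta g.
  have coefE lam : Defs.EM m lam -> Defs.EM m (fourier_coef eta lam).
    move=> /(EM_deriv_bound hm)[sl [h [B [h1 bl]]]].
    have [H H1 mH] := weight_fact_add_le hm.
    apply: (deriv_bound_EM hm _ (smooth_torus_fourier_coef eta sl)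
      (fourier_coef_decay hm eta 0 s_gt0 h1 H1 mH sl bl)).
    by rewrite mulr_gt0// (lt_le_trans ltr01).
  move=> Ef Eg; rewrite -[LHS]/(u_ eta (fourier_coef eta (a *: f + g))).
  rewrite fourier_coef_lin; last 2 first.
  - by apply: smooth_torus_continuous; case: Ef.
  - by apply: smooth_torus_continuous; case: Eg.
  by case: (u_dual eta) => -> //; exact: coefE.
have Scvg f : Defs.EM m f -> cvg (fourier_partial_sum u_ j f @[j --> \oo]).
  move=> /(EM_deriv_bound hm)[sf [h [B [h1 bf]]]].
  have [K _ HK] := bnd h h1; have [l Sl _] := HK f B sf bf.
  by apply/cvg_ex; exists l.
exists (fun f => lim (fourier_partial_sum u_ j f @[j --> \oo])).
split; last by move=> f /Scvg.
apply: (ultradistribution_of_bounds hm hhn) => [a f g Ef Eg|h h1].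
  apply: cvg_lim => //.
  have -> : (fun j => fourier_partial_sum u_ j (a *: f + g)) =
      (fun j => a * fourier_partial_sum u_ j f + fourier_partial_sum u_ j g).
    apply/funext => j; rewrite /fourier_partial_sum.
    have fin := @finite_freq_ball R s j.
    rewrite !fsbig_finite//= mulr_sumr -big_split /=.
    by apply: eq_bigr => eta _; exact: tlin.
  exact: (cvgD (cvgZl_tmp (k := a) (Scvg f Ef)) (Scvg g Eg)).
have [K K0 HK] := bnd h h1; exists K => // f B sf bf.
have [l Sl lB] := HK f B sf bf.
by rewrite (cvg_lim _ Sl).
Qed.
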